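(* Assume the Framework and the Purification Postulate. Let $\Psi\in\mathfrak S_1(\mathrm A\mathrm B)$ be a pure state and let $\mathrm A',\mathrm B'$ be copies of $\mathrm A,\mathrm B$. Then there exist an atomic effect $E_\Psi$ on $\mathrm B\mathrm A'$ and a probability $p_\Psi>0$ such that $(\mathcal I_{\mathrm A}\otimes E_\Psi\otimes\mathcal I_{\mathrm B'})(\Psi_{\mathrm A\mathrm B}\otimes\Psi_{\mathrm A'\mathrm B'})=p_\Psi\,\Psi_{\mathrm A\mathrm B'}$. Moreover, if the marginal $\rho=(\mathcal I_{\mathrm A}\otimes e_{\mathrm B})\Psi$ is internal, then with the same $E_\Psi,p_\Psi$ one has, as transformations from $\mathrm A'$ to $\mathrm A$, $(\mathcal I_{\mathrm A}\otimes E_\Psi)(\Psi_{\mathrm A\mathrm B}\otimes\mathcal I_{\mathrm A'})=p_\Psi\,\mathcal I$, where $\mathcal I$ denotes the identification of $\mathrm A'$ with $\mathrm A$ (probabilistic teleportation).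
   Context: Framework. We work in an operational-probabilistic theory: there is a collection of systems $\mathrm A,\mathrm B,\dots$, closed under a composition $\mathrm A\mathrm B$ (associative, symmetric up to a reversible swap, with a trivial system $\mathrm I$ satisfying $\mathrm A\mathrm I=\mathrm A$); for each pair of systems a set $\mathfrak T(\mathrm A,\mathrm B)$ of transformations; a test from $\mathrm A$ to $\mathrm B$ is a finite collection $\{\mathcal C_i\}_{i\in X}\subseteq\mathfrak T(\mathrm A,\mathrm B)$, and every transformation belongs to some test. Tests are closed under sequential composition, parallel composition ($\otimes$), coarse-graining (summing outcomes over the blocks of a partition of $X$) and conditioning (choosing the next test depending on the outcome of the previous one). States of $\mathrm A$ are the elements of $\mathfrak S(\mathrm A):=\mathfrak T(\mathrm I,\mathrm A)$, effects are the elements of $\mathfrak T(\mathrm A,\mathrm I)$, and transformations $\mathrm I\to\mathrm I$ are probabilities in $[0,1]$ (those of a test sum to $1$; composition is multiplication). An effect $a$ and a state $\rho$ give the probability $(a|\rho)$. States (effects) are identified when they give equal probabilities on all effects (states); transformations $\mathcal C,\mathcal C'$ are identified when $\mathcal C\otimes\mathcal I_{\mathrm S}$ and $\mathcal C'\otimes\mathcal I_{\mathrm S}$ act identically on all states of $\mathrm A\mathrm S$ for every system $\mathrm S$. States span a finite-dimensional real vector space $\mathfrak S_{\mathbb R}(\mathrm A)$, transformations act linearly, and $\mathfrak T_{\mathbb R}(\mathrm A,\mathrm B)$ is the real span of $\mathfrak T(\mathrm A,\mathrm B)$. Standing assumptions: (i) causality: each system $\mathrm A$ has a unique deterministic effect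 $e_{\mathrm A}$ (the effect forming a one-outcome observation test), and $e_{\mathrm A\mathrm B}=e_{\mathrm A}\otimes e_{\mathrm B}$; (ii) local discriminability: if two states of $\mathrm A\mathrm B$ differ, some product effect $a\otimes b$ gives them different probabilities; (iii) all sets of states are closed, the theory is not deterministic (hence all sets of states, effects and transformations are convex), and perfectly distinguishable states exist. A state $\rho$ is normalized if $(e|\rho)=1$; $\mathfrak S_1(\mathrm A)$ is the set of normalized states. A channel is a $\mathcal C\in\mathfrak T(\mathrm A,\mathrm B)$ with $e_{\mathrm B}\circ\mathcal C=e_{\mathrm A}$. A channel $\mathcal U\in\mathfrak T(\mathrm A,\mathrm B)$ is reversible if some channel $\mathcal W\in\mathfrak T(\mathrm B,\mathrm A)$ satisfies $\mathcal W\mathcal U=\mathcal I_{\mathrm A}$, $\mathcal U\mathcal W=\mathcal I_{\mathrm B}$; $\mathbf G_{\mathrm A}$ is the group of reversible channels on $\mathrm A$. The marginal of a state $\sigma$ of $\mathrm A\mathrm B$ on $\mathrm A$ is $(\mathcal I_{\mathrm A}\otimes e_{\mathrm B})\sigma$. Refinement. For $\mathcal C\in\mathfrak T(\mathrm A,\mathrm B)$, write $\mathcal D\prec\mathcal C$ if there are a test $\{\mathcal D_j\}_{j\in Y}$ and $Y_0\subseteq Y$ with $\mathcal C=\sum_{j\in Y_0}\mathcal D_j$ and $\mathcal D\in\{\mathcal D_j\}_{j\in Y_0}$; the refinement set is $D_{\mathcal C}=\{\mathcal D:\mathcal D\prec\mathcal C\}$. $\mathcal C$ is atomic if $\mathcal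 D\prec\mathcal C$ implies $\mathcal D=\lambda\mathcal C$ for some $\lambda\in[0,1]$. A pure state is an atomic state; a state is mixed otherwise. A state $\omega$ of $\mathrm A$ is internal if $\mathrm{Span}(D_\omega)=\mathfrak S_{\mathbb R}(\mathrm A)$. Purification Postulate. For every $\rho\in\mathfrak S_1(\mathrm A)$ there are a system $\mathrm B$ and a pure $\Psi\in\mathfrak S_1(\mathrm A\mathrm B)$ with $(\mathcal I_{\mathrm A}\otimes e_{\mathrm B})\Psi=\rho$ (a purification of $\rho$, with purifying system $\mathrm B$); and if $\Psi,\Psi'\in\mathfrak S_1(\mathrm A\mathrm B)$ are purifications of the same state, then $\Psi'=(\mathcal I_{\mathrm A}\otimes\mathcal U)\Psi$ for some $\mathcal U\in\mathbf G_{\mathrm B}$. A copy $\mathrm A'$ of $\mathrm A$ is a system operationally equivalent to $\mathrm A$ (connected to it by a fixed reversible channel, used to identify the two systems). *)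

(* Defs.v *)
From HB Require Import structures.
From mathcomp Require Import all_boot all_order all_algebra.
From mathcomp Require Import reals.
Set Implicit Arguments.
Unset Strict Implicit.
Unset Printing Implicit Defensive.
Import Order.TTheory GRing.Theory Num.Theory.
Local Open Scope ring_scope.

(* Data of an OPT.  Each system A is represented through its real state
   space S_R(A) = R^(sdim A); a transformation A -> B (up to operational
   identification) is the real matrix of its linear action S_R(A) -> S_R(B).
   States of A are sdim A x sdim I matrices (sdim I = 1), effects sdim I x sdim A,
   probabilities sdim I x sdim I.  [Test A B t] says that the finite list t is a
   test from A to B.  [eff A] is the deterministic effect of A (causality). *)
Unset Implicit Arguments.
Record OPT_data (R : realType) := {
  Sys : Type;
  sdim : Sys -> nat;
  sc : Sys -> Sys -> Sys;
  sI : Sys;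
  dim_sc : forall A B, sdim (sc A B) = (sdim A * sdim B)%N;
  dim_I : sdim sI = 1%N;
  sc_assoc : forall A B C, sc A (sc B C) = sc (sc A B) C;
  sc_I : forall A, sc A sI = A;
  Test : forall A B : Sys, seq 'M[R]_(sdim B, sdim A) -> Prop;
  eff : forall A : Sys, 'M[R]_(sdim sI, sdim A)
}.
Arguments Sys {R} o.
Arguments sdim {R} o _.
Arguments sc {R} o _ _.
Arguments sI {R} o.
Arguments dim_sc {R} o A B.
Arguments dim_I {R} o.
Arguments sc_assoc {R} o A B C.
Arguments sc_I {R} o A.
Arguments Test {R} o A B _.
Arguments eff {R} o A.
Set Implicit Arguments.

Section OPTdefs.
Variables (R : realType) (O : OPT_data R).
Local Notation Sys := (Sys O).
Local Notation sdim := (sdim O).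
Local Notation sc := (sc O).
Local Notation sI := (sI O).
Local Notation Test := (Test O).

Definition i0 : 'I_(sdim sI) := cast_ord (esym (dim_I O)) ord0.

(* index of the product basis vector (i,j) of S_R(AB) = S_R(A) (x) S_R(B) *)
Definition pidx (A B : Sys) (i : 'I_(sdim A)) (j : 'I_(sdim B)) : 'I_(sdim (sc A B)) :=
  cast_ord (esym (dim_sc O A B)) (mxvec_index i j).
Definition unpair (A B : Sys) (k : 'I_(sdim (sc A B))) : 'I_(sdim A) * 'I_(sdim B) :=
  enum_val (cast_ord (esym (mxvec_cast (sdim A) (sdim B))) (cast_ord (dim_sc O A B) k)).

Definition tens (A B C D : Sys) (M : 'M[R]_(sdim B, sdim A)) (N : 'M[R]_(sdim D, sdim C))
  : 'M[R]_(sdim (sc B D), sdim (sc A C)) :=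
  \matrix_(i, j) (M (unpair i).1 (unpair j).1 * N (unpair i).2 (unpair j).2).

Definition swapmx (A B : Sys) : 'M[R]_(sdim (sc B A), sdim (sc A B)) :=
  \matrix_(i, j) ((((unpair i).1 == (unpair j).2) && ((unpair i).2 == (unpair j).1))%:R).

Definition pr (p : 'M[R]_(sdim sI, sdim sI)) : R := p i0 i0.

Definition isT (A B : Sys) (M : 'M[R]_(sdim B, sdim A)) : Prop :=
  exists t, Test A B t /\ M \in t.

Definition channel (A B : Sys) (M : 'M[R]_(sdim B, sdim A)) : Prop :=
  isT M /\ eff O B *m M = eff O A.

Definition rev_pair (A B : Sys) (U : 'M[R]_(sdim B, sdim A)) (W : 'M[R]_(sdim A, sdim B))
  : Prop := channel U /\ channel W /\ W *m U = 1%:M /\ U *m W = 1%:M.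

Definition reversible (A B : Sys) (U : 'M[R]_(sdim B, sdim A)) : Prop :=
  exists W, rev_pair U W.

Definition normalized (A : Sys) (rho : 'M[R]_(sdim A, sdim sI)) : Prop :=
  pr (eff O A *m rho) = 1.

(* marginal on A of a state of AB: (I_A (x) e_B) sigma  (using AI = A) *)
Definition margA (A B : Sys) (s : 'M[R]_(sdim (sc A B), sdim sI)) : 'M[R]_(sdim A, sdim sI) :=
  \matrix_(i, j) \sum_(k < sdim B) eff O B i0 k * s (pidx i k) j.

Definition refines (A B : Sys) (D C : 'M[R]_(sdim B, sdim A)) : Prop :=
  exists (t : seq 'M[R]_(sdim B, sdim A)) (Y0 : pred nat),
    Test A B t /\ C = \sum_(i < size t | Y0 i) t`_i /\
    exists i : 'I_(size t), Y0 i /\ D = t`_i.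

Definition atomic (A B : Sys) (C : 'M[R]_(sdim B, sdim A)) : Prop :=
  isT C /\ forall D, refines D C -> exists l : R, 0 <= l <= 1 /\ D = l *: C.

Definition inspan (m n : nat) (P : 'M[R]_(m, n) -> Prop) (v : 'M[R]_(m, n)) : Prop :=
  exists (k : nat) (c : 'I_k -> R) (s : 'I_k -> 'M[R]_(m, n)),
    (forall i, P (s i)) /\ v = \sum_(i < k) c i *: s i.

Definition internal (A : Sys) (w : 'M[R]_(sdim A, sdim sI)) : Prop :=
  forall v : 'M[R]_(sdim A, sdim sI), inspan (fun D => refines D w) v.

(* (I_A (x) E (x) I_B')(Psi_AB (x) Phi_A'B'), a state of AB' *)
Definition IEI (A B A' B' : Sys) (E : 'M[R]_(sdim sI, sdim (sc B A')))
  (Psi : 'M[R]_(sdim (sc A B), sdim sI)) (Phi : 'M[R]_(sdim (sc A' B'), sdim sI))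
  : 'M[R]_(sdim (sc A B'), sdim sI) :=
  \matrix_(k, j) \sum_(b < sdim B) \sum_(a' < sdim A')
     E i0 (pidx b a') * Psi (pidx (unpair k).1 b) i0 * Phi (pidx a' (unpair k).2) i0.

(* (I_A (x) E)(Psi_AB (x) I_A'), a transformation A' -> A *)
Definition IE_tele (A B A' : Sys) (E : 'M[R]_(sdim sI, sdim (sc B A')))
  (Psi : 'M[R]_(sdim (sc A B), sdim sI)) : 'M[R]_(sdim A, sdim A') :=
  \matrix_(a, a') \sum_(b < sdim B) E i0 (pidx b a') * Psi (pidx a b) i0.

End OPTdefs.

Record OPT_axioms (R : realType) (O : OPT_data R) : Prop := {
  ax_id : forall A, Test O A A [:: 1%:M];
  ax_seq : forall A B C (t : seq 'M[R]_(sdim O B, sdim O A)) (u : seq 'M[R]_(sdim O C, sdim O B)),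
      Test O A B t -> Test O B C u -> Test O A C [seq y *m x | x <- t, y <- u];
  ax_par : forall A B C D (t : seq 'M[R]_(sdim O B, sdim O A)) (u : seq 'M[R]_(sdim O D, sdim O C)),
      Test O A B t -> Test O C D u -> Test O (sc O A C) (sc O B D) [seq tens x y | x <- t, y <- u];
  ax_coarse : forall A B (t : seq 'M[R]_(sdim O B, sdim O A)) (k : nat) (f : 'I_(size t) -> 'I_k),
      Test O A B t -> (forall j, exists i, f i = j) ->
      Test O A B [seq \sum_(i | f i == j) t`_i | j <- enum 'I_k];
  ax_cond : forall A B C (t : seq 'M[R]_(sdim O B, sdim O A)) (u : nat -> seq 'M[R]_(sdim O C, sdim O B)),
      Test O A B t -> (forall i, (i < size t)%N -> Test O B C (u i)) ->
      Test O A C (flatten [seq [seq y *m t`_i | y <- u i] | i <- iota 0 (size t)]);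
  ax_prob : forall t, Test O (sI O) (sI O) t ->
      (forall p, p \in t -> 0 <= pr p <= 1) /\ \sum_(p <- t) pr p = 1;
  ax_swap : forall A B, Test O (sc O A B) (sc O B A) [:: swapmx A B];
  ax_eff_det : forall A, Test O A (sI O) [:: eff O A];
  ax_eff_uniq : forall A e, Test O A (sI O) [:: e] -> e = eff O A;
  ax_eff_prod : forall A B i j, eff O (sc O A B) (i0 O) (pidx i j) = eff O A (i0 O) i * eff O B (i0 O) j;
  ax_locdisc : forall A B (r s : 'M[R]_(sdim O (sc O A B), sdim O (sI O))),
      isT r -> isT s -> r <> s ->
      exists (a : 'M[R]_(sdim O (sI O), sdim O A)) (b : 'M[R]_(sdim O (sI O), sdim O B)),
        isT a /\ isT b /\ tens a b *m r <> tens a b *m s;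
  (* sdim A is the dimension of S_R(A), and states are identified by effects *)
  ax_span : forall A (v : 'M[R]_(sdim O A, sdim O (sI O))), inspan (@isT R O (sI O) A) v;
  ax_sep : forall A (r s : 'M[R]_(sdim O A, sdim O (sI O))), isT r -> isT s ->
      (forall e : 'M[R]_(sdim O (sI O), sdim O A), isT e -> e *m r = e *m s) -> r = s;
  ax_closed : forall A (r : 'M[R]_(sdim O A, sdim O (sI O))),
      (forall eps : R, 0 < eps -> exists s, isT s /\ forall i j, `|r i j - s i j| < eps) -> isT r;
  ax_nondet : exists p : 'M[R]_(sdim O (sI O), sdim O (sI O)), isT p /\ 0 < pr p < 1;
  ax_pdist : exists A (r0 r1 : 'M[R]_(sdim O A, sdim O (sI O))) (e0 e1 : 'M[R]_(sdim O (sI O), sdim O A)),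
      [/\ isT r0, isT r1, normalized r0, normalized r1 &
        [/\ Test O A (sI O) [:: e0; e1],
            pr (e0 *m r0) = 1, pr (e0 *m r1) = 0, pr (e1 *m r0) = 0 & pr (e1 *m r1) = 1]]
}.

Definition Purification (R : realType) (O : OPT_data R) : Prop :=
  (forall A (rho : 'M[R]_(sdim O A, sdim O (sI O))), isT rho -> normalized rho ->
     exists B (Psi : 'M[R]_(sdim O (sc O A B), sdim O (sI O))),
       atomic Psi /\ normalized Psi /\ margA Psi = rho) /\
  (forall A B (Psi Psi' : 'M[R]_(sdim O (sc O A B), sdim O (sI O))),
     atomic Psi -> normalized Psi -> atomic Psi' -> normalized Psi' ->
     margA Psi = margA Psi' ->
     exists U : 'M[R]_(sdim O B, sdim O B), reversible U /\ Psi' = tens 1%:M U *m Psi).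

(* Main.v *)
Require Import Defs.
From mathcomp Require Import all_boot all_order all_algebra.
From mathcomp Require Import all_classical reals topology normedtype sequences derive ring lra.
Import Order.TTheory GRing.Theory Num.Theory.
Import numFieldNormedType.Exports.
(* [ssrbool.isT] would otherwise hide [Defs.isT]. *)
Import Defs.
Local Open Scope ring_scope.
Set Implicit Arguments.
Unset Strict Implicit.
Unset Printing Implicit Defensive.

(** Write a state of AB as the matrix P of its coordinates.  The teleportation
    identity becomes P E Q = p T, where P, Q, T are the matrices of the states
    of AB, A'B', AB'; a generalized inverse of P provides a (non-physical)
    solution X of P X Q = T.  Since the deterministic effect e is an order unit
    among effects, c e - X is positive for large c, so T / c refines the
    marginal of the product state on AB', and the steering property of
    purifications turns it into an effect on BA'.

    To make that effect atomic, purify an order unit of the state cone of BA'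
    with a system C: effects on BA' correspond linearly and injectively, up to
    scaling, to the states of C in the face of the complementary marginal.  The
    normalized states of that face whose effect solves P E Q = p T form a compact
    face, and maximizing a linear functional plus a small multiple of the squared
    norm over it finds a pure state with p > 0; its effect is atomic. *)

(** * Extreme points *)

Section Extreme.
Variables (R : realType) (n : nat).

(** By compactness, [f] plus a small multiple of the squared norm has a maximizer. Strict convexity
    of the square makes it extreme, and the multiple is small enough to keep [f] positive there. *)
Lemma closed_bounded_extreme (S : 'cV[R]_n -> Prop) (M : R) (f : 'rV[R]_n) (v0 : 'cV[R]_n) :
  (forall v : 'cV[R]_n, (forall eps, 0 < eps -> exists w, S w /\ forall i, `|v i 0 - w i 0| < eps) -> S v) ->
  (forall v, S v -> forall i, `|v i 0| <= M) ->
  S v0 -> 0 < (f *m v0) 0 0 ->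
  exists v, [/\ S v, 0 < (f *m v) 0 0 &
    forall u w l, S u -> S w -> 0 < l < 1 -> v = l *: u + (1 - l) *: w -> u = v /\ w = v].
Proof.
move=> clS bdS S0 f0.
have fE (v : 'cV[R]_n) : (f *m v) 0 0 = \sum_i f 0 i * v i 0 by rewrite mxE.
have M0 : 0 <= M.
  case: (pickP (@predT 'I_n)) => [i _|no]; first exact: le_trans (bdS _ S0 i).
  by move: f0; rewrite fE big1 ?ltxx // => i _; have := no i.
pose N : R := \sum_(i < n) M ^+ 2.
have N0 : 0 <= N by apply: sumr_ge0 => i _; exact: sqr_ge0.
(* As [eps * N] stays below the value of [f] at [v0], any point where [g] is at least [g v0] still
   has positive [f]. *)
pose eps := (f *m v0) 0 0 / (2 * (N + 1)).
have eps0 : 0 < eps by rewrite divr_gt0 // mulr_gt0 //; lra.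
have epsN : eps * N < (f *m v0) 0 0.
  rewrite /eps mulrAC ltr_pdivrMr; last by lra.
  by rewrite ltr_pM2l //; lra.
pose q (v : 'cV[R]_n) := \sum_i v i 0 ^+ 2.
have qN v : S v -> q v <= N.
  move=> Sv; apply: ler_sum => i _.
  by rewrite -real_normK ?num_real // !expr2 ler_pM ?normr_ge0 ?bdS.
have q0 v : 0 <= q v by apply: sumr_ge0 => i _; exact: sqr_ge0.
pose g (v : 'cV[R]_n) := (f *m v) 0 0 + eps * q v.
have [v [Sv vmax]] : exists v, S v /\ forall w, S w -> g w <= g v.
  pose A := [set x : 'rV[R]_n | S x^T]%classic.
  have cA : compact A.
    apply: bounded_closed_compact.
      exists M; split; first exact: num_real.
      move=> x Mx y Ay /=; apply: (le_trans _ (ltW Mx)).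
      rewrite [leLHS]/Num.norm /= mx_normrE.
      apply/bigmax_leP; split=> // -[i j] _ /=.
      by rewrite ord1; have := bdS _ Ay j; rewrite mxE.
    move=> x clx; apply: clS => e e0.
    have [y [Ay /= xy]] := clx _ (nbhsx_ballx x e e0).
    exists y^T; split=> // i.
    by rewrite !mxE; case: xy => _; apply.
  have A0 : (A !=set0)%classic by exists v0^T; rewrite /A /= trmxK.
  have cf : ({within A, continuous (fun x : 'rV[R]_n => g x^T)})%classic.
    have -> : (fun x : 'rV[R]_n => g x^T) =
              (fun x => \sum_i (f 0 i * x 0 i + eps * (x 0 i * x 0 i))).
      apply/funext => x; rewrite /g fE /q mulr_sumr -big_split/=.
      by apply: eq_bigr => i _; rewrite mxE expr2.
    apply: continuous_subspaceT; apply: continuous_big => [|i _ x]; first exact: add_continuous.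
    have cx : ((fun y : 'rV[R]_n => y 0 i : R) @ x --> (x 0 i : R))%classic by exact: coord_continuous.
    exact: (cvgD (cvgM (cvg_cst _) cx) (cvgM (cvg_cst _) (cvgM cx cx))).
  have [c cA' cmax] := compact_EVT_max A0 cA cf.
  exists c^T; split; first by rewrite inE in cA'.
  by move=> w Sw; have := cmax w^T; rewrite trmxK; apply; rewrite inE /A/= trmxK.
exists v; split=> //.
  have := vmax _ S0; rewrite /g.
  have := qN _ Sv; have := q0 v0 => q00 qv.
  have : eps * q v <= eps * N by rewrite ler_pM2l.
  have : 0 <= eps * q v0 by rewrite mulr_ge0 // ltW.
  by lra.
move=> u w l Su Sw /andP[l0 l1] vE.
pose d := q (u - w).
(* The convexity defect of [g] on the segment is exactly the term in [d]; maximality at [v] forces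
   [d] to vanish. *)
have gE : g v = l * g u + (1 - l) * g w - eps * (l * (1 - l)) * d.
  rewrite /g /d /q vE !fE !mulr_sumr -!big_split/= !mulr_sumr -!big_split/= -sumrB.
  by apply: eq_bigr => i _; rewrite !mxE; ring.
have d0 : 0 <= d by exact: q0.
have := vmax _ Su; have := vmax _ Sw => gw gu.
have ld : eps * (l * (1 - l)) * d <= 0.
  have : l * g u <= l * g v by rewrite ler_pM2l.
  have : (1 - l) * g w <= (1 - l) * g v by rewrite ler_pM2l // subr_gt0.
  by move: gE; lra.
have {}d0 : d = 0.
  apply/eqP; rewrite eq_le d0 andbT.
  by move: ld; rewrite pmulr_rle0 // mulr_gt0 // mulr_gt0 // subr_gt0.
have uw : u = w.
  apply/matrixP => i j; rewrite ord1; apply/eqP; rewrite -subr_eq0 -sqrf_eq0.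
  move/eqP: d0; rewrite psumr_eq0; last by move=> *; exact: sqr_ge0.
  by move=> /allP/(_ i (mem_index_enum _)); rewrite /= !mxE.
by subst w; rewrite vE -scalerDl addrC subrK scale1r.
Qed.
End Extreme.

(** * Numbering of product bases *)

Lemma index_allpairs_pair (S T : eqType) (s : seq S) (t : seq T) x y :
  x \in s -> y \in t ->
  index (x, y) [seq (a, b) | a <- s, b <- t] = (index x s * size t + index y t)%N.
Proof.
elim: s => //= a s IH; rewrite inE => xs yt.
rewrite index_cat size_map [x == a]eq_sym in xs *.
have inj : injective (fun b : T => (a, b)) by move=> ? ? [].
case: (eqVneq a x) xs => [<- _|ax]; last rewrite orFb => xs.
  by rewrite mem_map // yt index_map.
have -> : ((x, y) \in [seq (a, b) | b <- t]) = false.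
  by apply/negbTE/mapP => -[b _ [xa _]]; rewrite xa eqxx in ax.
by rewrite IH // mulSn addnA.
Qed.

(** Row-major values number the basis of a triple product alike in both bracketings, so that
    associativity becomes an identity of indices. *)
Lemma enum_rank_pair m n (i : 'I_m) (j : 'I_n) :
  enum_rank (i, j) = (i * n + j)%N :> nat.
Proof.
rewrite /enum_rank [enum_rank_in]unlock insubdK; last first.
  by rewrite -topredE/= cardE index_mem mem_enum.
have -> : enum (@predT ('I_m * 'I_n)%type) = [seq (a, b) | a <- enum 'I_m, b <- enum 'I_n].
  by rewrite enumT unlock.
by rewrite index_allpairs_pair ?mem_enum // !index_enum_ord size_enum_ord.
Qed.

Section Index.
Variables (R : realType) (O : OPT_data R).

Lemma val_pidx (A B : Sys O) (i : 'I_(sdim O A)) (j : 'I_(sdim O B)) :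
  pidx i j = (i * sdim O B + j)%N :> nat.
Proof. by rewrite /pidx /= enum_rank_pair. Qed.

Lemma pidxK (A B : Sys O) (i : 'I_(sdim O A)) (j : 'I_(sdim O B)) :
  unpair (pidx i j) = (i, j).
Proof. by rewrite /unpair /pidx cast_ordKV cast_ordK enum_rankK. Qed.

Lemma unpairK (A B : Sys O) (k : 'I_(sdim O (sc O A B))) :
  pidx (unpair k).1 (unpair k).2 = k.
Proof.
rewrite /pidx /unpair /mxvec_index -surjective_pairing enum_valK.
by rewrite cast_ordKV cast_ordK.
Qed.

Lemma sum_pidx (A B : Sys O) (F : 'I_(sdim O (sc O A B)) -> R) :
  \sum_k F k = \sum_i \sum_j F (pidx i j).
Proof.
rewrite pair_big (reindex (fun p : 'I_(sdim O A) * 'I_(sdim O B) => pidx p.1 p.2)) //=.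
exists (@unpair R O A B) => [[i j]|k] _; first exact: pidxK.
exact: unpairK.
Qed.

Lemma ordI (i : 'I_(sdim O (sI O))) : i = i0 O.
Proof. by apply/val_inj => /=; case: i => i /=; rewrite dim_I; case: i. Qed.
End Index.

(** * Tests *)

Section Tests.
Variables (R : realType) (O : OPT_data R) (HO : OPT_axioms O).
Local Notation S1 := (sI O).
Local Notation Test := (Test O).

(* [sdim sI = 1] holds only propositionally; states and effects are handled as
   genuine column and row vectors through these conversions. *)
Definition stv A (v : 'cV[R]_(sdim O A)) : 'M[R]_(sdim O A, sdim O S1) := \matrix_(i, j) v i 0.
Definition rwv A (b : 'rV[R]_(sdim O A)) : 'M[R]_(sdim O S1, sdim O A) := \matrix_(i, j) b 0 j.
Definition ev A : 'rV[R]_(sdim O A) := row (i0 O) (eff O A).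

Lemma stvK A (s : 'M[R]_(sdim O A, sdim O S1)) : stv (col (i0 O) s) = s.
Proof. by apply/matrixP => i j; rewrite !mxE (ordI j). Qed.

Lemma col_stv A (v : 'cV[R]_(sdim O A)) : col (i0 O) (stv v) = v.
Proof. by apply/matrixP => i j; rewrite !mxE ord1. Qed.

Lemma rwvK A (b : 'M[R]_(sdim O S1, sdim O A)) : rwv (row (i0 O) b) = b.
Proof. by apply/matrixP => i j; rewrite !mxE (ordI i). Qed.

Lemma row_rwv A (b : 'rV[R]_(sdim O A)) : row (i0 O) (rwv b) = b.
Proof. by apply/matrixP => i j; rewrite !mxE ord1. Qed.

Lemma mul_stv A B (M : 'M[R]_(sdim O B, sdim O A)) v : M *m stv v = stv (M *m v).
Proof. by apply/matrixP => i j; rewrite !mxE; apply: eq_bigr => k _; rewrite mxE. Qed.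

Lemma rwv_mul A B (M : 'M[R]_(sdim O B, sdim O A)) b : rwv b *m M = rwv (b *m M).
Proof. by apply/matrixP => i j; rewrite !mxE; apply: eq_bigr => k _; rewrite mxE. Qed.

Lemma pr_rwv_stv A (b : 'rV[R]_(sdim O A)) (v : 'cV[R]_(sdim O A)) :
  pr (rwv b *m stv v) = (b *m v) 0 0.
Proof. by rewrite /pr !mxE; apply: eq_bigr => k _; rewrite !mxE. Qed.

Lemma isT_test A B (M : 'M[R]_(sdim O B, sdim O A)) : Test A B [:: M] -> isT M.
Proof. by move=> h; exists [:: M]; rewrite inE. Qed.

Lemma isT_id A : isT (1%:M : 'M[R]_(sdim O A, sdim O A)).
Proof. exact: isT_test (ax_id HO A). Qed.

Lemma isT_eff A : isT (eff O A).
Proof. exact: isT_test (ax_eff_det HO A). Qed.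

Lemma isT_mul A B C (N : 'M[R]_(sdim O C, sdim O B)) (M : 'M[R]_(sdim O B, sdim O A)) :
  isT N -> isT M -> isT (N *m M).
Proof.
move=> [u [tu Nu]] [t [tt Mt]]; exists [seq y *m x | x <- t, y <- u]; split.
  exact: ax_seq.
by apply/allpairsP; exists (M, N).
Qed.

Lemma isT_tens A B C D (M : 'M[R]_(sdim O B, sdim O A)) (N : 'M[R]_(sdim O D, sdim O C)) :
  isT M -> isT N -> isT (tens M N).
Proof.
move=> [t [tt Mt]] [u [tu Nu]]; exists [seq tens x y | x <- t, y <- u]; split.
  exact: ax_par.
by apply/allpairsP; exists (M, N).
Qed.

Lemma prob_ge0 (p : 'M[R]_(sdim O S1, sdim O S1)) : isT p -> 0 <= pr p.
Proof. by move=> [t [tt pt]]; have [/(_ _ pt)/andP[]] := ax_prob HO tt. Qed.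

Lemma prob_le1 (p : 'M[R]_(sdim O S1, sdim O S1)) : isT p -> pr p <= 1.
Proof. by move=> [t [tt pt]]; have [/(_ _ pt)/andP[]] := ax_prob HO tt. Qed.

Lemma prP (p q : 'M[R]_(sdim O S1, sdim O S1)) : pr p = pr q -> p = q.
Proof. by move=> pq; apply/matrixP => i j; rewrite (ordI i) (ordI j). Qed.

Lemma pr1 : pr (1%:M : 'M[R]_(sdim O S1, sdim O S1)) = 1.
Proof. by rewrite /pr mxE eqxx. Qed.

Lemma eff1 : eff O S1 = 1%:M.
Proof. by rewrite -(ax_eff_uniq HO (ax_id HO S1)). Qed.

Lemma sum_nth (V : nmodType) (t : seq V) : \sum_(i < size t) t`_i = \sum_(x <- t) x.
Proof. by rewrite (big_nth 0) big_mkord. Qed.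

Lemma test_sum A B (t : seq 'M[R]_(sdim O B, sdim O A)) :
  Test A B t -> (0 < size t)%N -> Test A B [:: \sum_(x <- t) x].
Proof.
move=> tt t0; have := @ax_coarse _ _ HO A B t 1 (fun _ => ord0) tt.
rewrite enum_ordSl enum_ord0/= sum_nth; apply => j.
by exists (Ordinal t0); rewrite (ord1 j).
Qed.

Lemma coarse2 A B (t : seq 'M[R]_(sdim O B, sdim O A)) (P : pred nat) :
  Test A B t -> (exists2 i, (i < size t)%N & P i) -> (exists2 i, (i < size t)%N & ~~ P i) ->
  Test A B [:: \sum_(i < size t | P i) t`_i; \sum_(i < size t | ~~ P i) t`_i].
Proof.
move=> tt [i it Pi] [j jt Pj].
have := @ax_coarse _ _ HO A B t 2 (fun i => if P i then ord0 else lift ord0 ord0) tt.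
rewrite !enum_ordSl enum_ord0/=.
rewrite [X in [:: X; _]](eq_bigl (fun i : 'I_(size t) => P i)); last by move=> k /=; case: ifP.
rewrite [X in [:: _; X]](eq_bigl (fun i : 'I_(size t) => ~~ P i)); last by move=> k /=; case: ifP.
apply=> k; case: (unliftP ord0 k) => [l ->|->].
  by exists (Ordinal jt); rewrite /= (negPf Pj) (ord1 l).
by exists (Ordinal it); rewrite /= Pi.
Qed.

Lemma size_gt0 (T : eqType) (x : T) s : x \in s -> (0 < size s)%N.
Proof. by case: s. Qed.

(** The impossible outcome serves to pad tests with zeros. Measure [e0], [e1] on the sum of a test
    containing [r1]: [e1] is already certain on [r1], so nothing is left for [e0]. *)
Lemma test_zero_one : Test S1 S1 [:: 0; 1%:M].
Proof.
have [A [r0 [r1 [e0 [e1 [_ [t [tt rt]] _ _ [te _ _ _ p11]]]]]]] := ax_pdist HO.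
have tr := test_sum tt (size_gt0 rt); set r := \sum_(x <- t) x in tr.
have /= tp := ax_seq HO tr te.
have e1T : isT e1 by exists [:: e0; e1]; rewrite !inE eqxx orbT.
have [p01 psum] := ax_prob HO tp.
have q1 : pr (e1 *m r) = 1.
  apply/eqP; rewrite eq_le; have /andP[_ ->] := p01 (e1 *m r) ltac:(by rewrite !inE eqxx orbT).
  rewrite -p11 /r (perm_big _ (perm_to_rem rt)) big_cons/= mulmxDr /pr [leRHS]mxE lerDl.
  rewrite mulmx_sumr summxE big_seq; apply: sumr_ge0 => x xt; apply: prob_ge0.
  by apply: isT_mul => //; exists t; split=> //; apply: mem_rem xt.
have q0 : pr (e0 *m r) = 0.
  by move: psum; rewrite !big_cons big_nil q1; lra.
have E0 : e0 *m r = 0 by apply: prP; rewrite q0 /pr mxE.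
have E1 : e1 *m r = 1%:M by apply: prP; rewrite q1 pr1.
by rewrite E0 E1 in tp.
Qed.

(** Coarse-graining needs nonempty blocks. Padding [t] with zero outcomes provides them even if [P]
    selects everything or nothing. *)
Lemma subsum_isT A (t : seq 'M[R]_(sdim O A, sdim O S1)) (P : pred nat) :
  Test S1 A t -> exists M',
    Test S1 A [:: \sum_(i < size t | P i) t`_i; M'].
Proof.
move=> tt.
have t0 : (0 < size t)%N.
  have [_] := ax_prob HO (ax_seq HO tt (ax_eff_det HO A)).
  by case: (t) => //=; rewrite big_nil => /eqP; rewrite eq_sym oner_eq0.
have := ax_seq HO test_zero_one tt; rewrite /= cats0.
under [in X in X ++ _]eq_map do rewrite mulmx0.
under [in X in _ ++ X]eq_map do rewrite mulmx1.
rewrite map_id; set z := map _ _ => tz.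
have sz : size z = size t by rewrite size_map.
(* [z] consists of [size t] zeros; [Q] is [P] shifted past them. *)
pose Q := [pred i | (size t <= i)%N && P (i - size t)%N].
have sumQ : \sum_(i < size (z ++ t) | Q i) (z ++ t)`_i = \sum_(i < size t | P i) t`_i.
  rewrite -!(big_mkord _ (fun i => _`_i)) size_cat sz.
  rewrite (@big_cat_nat _ _ _ (size t)) ?leq_addr //= big_nat_cond big1 ?add0r; last first.
    by move=> i /andP[/andP[_ ilt] /andP[]]; rewrite leqNgt ilt.
  rewrite -{1}[size t]add0n big_addn addnK.
  apply: eq_big => i; first by rewrite leq_addl addnK.
  by move=> _; rewrite nth_cat sz ltnNge leq_addl addnK.
case: (boolP [exists i : 'I_(size t), P i]) => [/existsP[i Pi]|/existsPn noP].
  have := coarse2 (P := Q) tz; rewrite sumQ => c2.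
  eexists; apply: c2.
    by exists (size t + i)%N; rewrite ?size_cat ?sz ?ltn_add2l //= leq_addr addKn.
  by exists 0%N; rewrite ?size_cat ?sz ?addn_gt0 ?t0 //= leqNgt t0.
(* An empty selection is replaced by the padding outcome at index 0, which is zero. *)
have -> : \sum_(i < size t | P i) t`_i = \sum_(i < size (z ++ t) | i == 0%N :> nat) (z ++ t)`_i.
  rewrite big1; last by move=> i Pi; have := noP i; rewrite Pi.
  have hz : (0 < size (z ++ t))%N by rewrite size_cat sz addn_gt0 t0.
  rewrite (big_pred1 (Ordinal hz)) /=; last by [].
  by rewrite nth_cat sz t0 (nth_map 0).
eexists; apply: (coarse2 (P := fun i => i == 0%N) tz).
  by exists 0%N; rewrite ?size_cat ?sz ?addn_gt0 ?t0.
by exists (size t); rewrite ?size_cat ?sz -?lt0n // -[X in (X < _)%N]addn0 ltn_add2l.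
Qed.

Lemma isT_split A (s : 'M[R]_(sdim O A, sdim O S1)) : isT s -> exists s', Test S1 A [:: s; s'].
Proof.
move=> [t [tt st]]; have := subsum_isT (fun i => i == index s t) tt.
have it : (index s t < size t)%N by rewrite index_mem.
by rewrite (big_pred1 (Ordinal it)) /= ?nth_index.
Qed.

Lemma isT_subsum A (t : seq 'M[R]_(sdim O A, sdim O S1)) (P : pred nat) :
  Test S1 A t -> isT (\sum_(i < size t | P i) t`_i).
Proof. by move=> /(subsum_isT P)[M' h]; exists [:: \sum_(i < size t | P i) t`_i; M']; rewrite inE eqxx. Qed.

Lemma isT_cond2 A B (x0 x1 : 'M[R]_(sdim O A, sdim O S1)) (y0 y1 : 'M[R]_(sdim O B, sdim O A)) :
  Test S1 A [:: x0; x1] -> isT y0 -> isT y1 -> isT (y0 *m x0 + y1 *m x1).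
Proof.
move=> tx [u0 [tu0 yu0]] [u1 [tu1 yu1]].
have := ax_cond HO (u := fun i => if i is 0%N then u0 else u1) tx.
rewrite /= cats0; set w := _ ++ _ => tw.
have {}tw : Test S1 B w by apply: tw => -[|[|]].
(* Positions of the branches [y0 *m x0] and [y1 *m x1] in the conditioned test [w]. *)
pose a := index y0 u0; pose b := (size u0 + index y1 u1)%N.
have ha : (a < size u0)%N by rewrite index_mem.
have hb : (index y1 u1 < size u1)%N by rewrite index_mem.
have := isT_subsum [pred i | (i == a) || (i == b)] tw.
have wa : (a < size w)%N by rewrite size_cat !size_map ltn_addr.
have wb : (b < size w)%N by rewrite size_cat !size_map ltn_add2l.
have ab : Ordinal wb != Ordinal wa by rewrite -val_eqE /= /b gtn_eqF // ltn_addr.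
rewrite (bigD1 (Ordinal wa)) /= ?eqxx // (big_pred1 (Ordinal wb)) /=; last first.
  move=> i; apply/andP/eqP => [[/orP[/eqP ia|/eqP ib] ni]|->].
  - by case/eqP: ni; apply/val_inj.
  - exact/val_inj.
  - by rewrite eqxx orbT.
have -> : w`_a = y0 *m x0 by rewrite nth_cat size_map ha (nth_map 0) // nth_index.
have -> // : w`_b = y1 *m x1.
by rewrite nth_cat size_map ltnNge leq_addr /= addKn (nth_map 0) // nth_index.
Qed.

End Tests.

(** * The cone of states *)

Section Cone.
Variables (R : realType) (O : OPT_data R) (HO : OPT_axioms O).
Local Notation S1 := (sI O).
Local Notation Test := (Test O).

Definition is_state A (v : 'cV[R]_(sdim O A)) := isT (stv v).
Definition is_effect A (b : 'rV[R]_(sdim O A)) := isT (rwv b).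
(** Membership of 0 requires that [A] has some state, which is why several later statements carry it
    as a hypothesis. *)
Definition cone A (v : 'cV[R]_(sdim O A)) := exists c s, [/\ 0 <= c, is_state s & v = c *: s].

Lemma stvD A (v w : 'cV[R]_(sdim O A)) : stv (v + w) = stv v + stv w.
Proof. by apply/matrixP => i j; rewrite !mxE. Qed.

Lemma stvZ A c (v : 'cV[R]_(sdim O A)) : stv (c *: v) = c *: stv v.
Proof. by apply/matrixP => i j; rewrite !mxE. Qed.

Lemma stv0 A : stv (0 : 'cV[R]_(sdim O A)) = 0.
Proof. by apply/matrixP => i j; rewrite !mxE. Qed.

Lemma eff_rwv A : eff O A = rwv (ev A).
Proof. by rewrite rwvK. Qed.

Lemma effect_ev A : is_effect (ev A).
Proof. by rewrite /is_effect -eff_rwv; exact: isT_eff. Qed.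

Lemma state_mul A B (M : 'M[R]_(sdim O B, sdim O A)) v : isT M -> is_state v -> is_state (M *m v).
Proof. by rewrite /is_state -mul_stv; exact: isT_mul. Qed.

Lemma effect_mul A B (M : 'M[R]_(sdim O B, sdim O A)) b : isT M -> is_effect b -> is_effect (b *m M).
Proof. by rewrite /is_effect -rwv_mul => hM hb; exact: isT_mul. Qed.

Lemma effect_ge0 A (b : 'rV[R]_(sdim O A)) v : is_effect b -> is_state v -> 0 <= (b *m v) 0 0.
Proof. by move=> hb hv; rewrite -pr_rwv_stv; apply: prob_ge0 => //; exact: isT_mul. Qed.

Lemma effect_le1 A (b : 'rV[R]_(sdim O A)) v : is_effect b -> is_state v -> (b *m v) 0 0 <= 1.
Proof. by move=> hb hv; rewrite -pr_rwv_stv; apply: prob_le1 => //; exact: isT_mul. Qed.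

(** The outcomes of a test containing [b] sum to a deterministic effect, identified with [ev A] by
    causality; the other outcomes form the complement. *)
Lemma effect_compl A (b : 'rV[R]_(sdim O A)) : is_effect b ->
  exists bs : seq 'rV[R]_(sdim O A), (forall x, x \in bs -> is_effect x) /\ ev A = b + \sum_(x <- bs) x.
Proof.
move=> [t [tt bt]].
have := test_sum HO tt (size_gt0 bt) => /(ax_eff_uniq HO) tE.
exists [seq row (i0 O) x | x <- rem (rwv b) t]; split.
  move=> _ /mapP[x xt ->]; rewrite /is_effect rwvK; exists t; split=> //; exact: mem_rem xt.
rewrite /ev -tE (perm_big _ (perm_to_rem bt)) big_cons/= linearD/= row_rwv; congr (_ + _).
by rewrite big_map linear_sum.
Qed.

Lemma effect_le_ev A (b : 'rV[R]_(sdim O A)) v : is_effect b -> is_state v -> (b *m v) 0 0 <= (ev A *m v) 0 0.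
Proof.
move=> /effect_compl[bs [hbs ->]] hv; rewrite mulmxDl [leRHS]mxE lerDl.
rewrite mulmx_suml summxE big_seq; apply: sumr_ge0 => x /hbs xE; exact: effect_ge0.
Qed.

Lemma state_0 A (v : 'cV[R]_(sdim O A)) : is_state v -> is_state (0 : 'cV[R]_(sdim O A)).
Proof.
move=> [t [tt _]]; have := isT_subsum HO (@pred0 nat) tt.
by rewrite big_pred0 // /is_state stv0.
Qed.

Lemma stv_inj A : injective (@stv R O A).
Proof. by move=> v w vw; rewrite -(col_stv v) vw col_stv. Qed.

Lemma state_sep A (v w : 'cV[R]_(sdim O A)) : is_state v -> is_state w ->
  (forall b, is_effect b -> (b *m v) 0 0 = (b *m w) 0 0) -> v = w.
Proof.
move=> hv hw bvw; apply: stv_inj; apply: (ax_sep HO) => // e eT.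
apply: prP; rewrite -(rwvK e) !pr_rwv_stv; apply: bvw.
by rewrite /is_effect rwvK.
Qed.

Lemma state_e0 A (v : 'cV[R]_(sdim O A)) : is_state v -> (ev A *m v) 0 0 = 0 -> v = 0.
Proof.
move=> hv v0; apply: state_sep => //; first exact: state_0 hv.
move=> b hb; rewrite mulmx0 [RHS]mxE; apply/eqP; rewrite eq_le effect_ge0 // andbT.
by rewrite -v0 effect_le_ev.
Qed.

Lemma expr_small (q eps : R) : 0 <= q < 1 -> 0 < eps -> exists n, q ^+ n < eps.
Proof.
move=> /andP[q0 q1] e0.
have /cvg_expr/cvgrPdist_lt/(_ eps e0)[N _ /(_ N (leqnn N))] : `|q| < 1 by rewrite ger0_norm.
by rewrite /= sub0r normrN ger0_norm ?exprn_ge0 // => h; exists N.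
Qed.

Lemma state_closed A (v : 'cV[R]_(sdim O A)) :
  (forall eps, 0 < eps -> exists w, is_state w /\ forall i, `|v i 0 - w i 0| < eps) -> is_state v.
Proof.
move=> h; apply: (ax_closed HO) => eps /h[w [hw vw]].
by exists (stv w); split=> // i j; rewrite !mxE.
Qed.

Lemma state_closed_line A (v : 'cV[R]_(sdim O A)) (x : R) :
  (forall eps, 0 < eps -> exists y, is_state (y *: v) /\ `|x - y| < eps) -> is_state (x *: v).
Proof.
move=> h; apply: state_closed => eps e0.
(* [m] exceeds every coordinate of [v] in absolute value, and the summand 1 keeps it positive when
   [v] vanishes. *)
pose m := 1 + \sum_i `|v i 0|.
have s0 : 0 <= \sum_i `|v i 0| by apply: sumr_ge0.
have m0 : 0 < m by rewrite /m; lra.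
have [y [hy xy]] := h (eps / m) ltac:(by rewrite divr_gt0).
exists (y *: v); split=> // i; rewrite !mxE -mulrBl normrM.
rewrite ltr_pdivlMr // in xy; apply: le_lt_trans xy; rewrite ler_wpM2l //.
rewrite /m (bigD1 i) //=.
have : 0 <= \sum_(j | j != i) `|v j 0| by apply: sumr_ge0.
lra.
Qed.

Lemma test_prob2 A (x y : 'M[R]_(sdim O A, sdim O S1)) : Test S1 A [:: x; y] ->
  pr (eff O A *m x) + pr (eff O A *m y) = 1.
Proof.
move=> txy; have [_] := ax_prob HO (ax_seq HO txy (ax_eff_det HO A)).
by rewrite !big_cons big_nil addr0.
Qed.

(* Repeat the preparation until it succeeds: n rounds prepare ((1 - q ^+ n) / p) *: v,
   where p and q are the probabilities of success and failure. *)
Lemma state_normalize A (v : 'cV[R]_(sdim O A)) : is_state v -> 0 < (ev A *m v) 0 0 ->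
  is_state (((ev A *m v) 0 0)^-1 *: v).
Proof.
move=> hv; set p := (_ *m _) 0 0 => p0.
have [s' ts] := isT_split HO hv.
pose q := pr (eff O A *m s').
have pq : p + q = 1 by have := test_prob2 ts; rewrite eff_rwv pr_rwv_stv -eff_rwv.
have q0 : 0 <= q.
  apply: (prob_ge0 HO); apply: isT_mul => //; first exact: isT_eff.
  by exists [:: stv v; s']; rewrite !inE eqxx orbT.
have hr n : is_state (((1 - q ^+ n) / p) *: v).
  elim: n => [|n IH]; first by rewrite expr0 subrr mul0r scale0r; exact: state_0 hv.
  have := isT_cond2 HO ts (isT_id HO A) (isT_mul HO IH (isT_eff HO A)).
  rewrite mul1mx -mulmxA [eff O A *m s'](_ : _ = q%:M); last first.
    by apply: prP; rewrite [RHS]/pr mxE eqxx.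
  rewrite mul_mx_scalar -stvZ -stvD scalerA -{1}[v]scale1r -scalerDl.
  congr (is_state (_ *: _)); rewrite exprS.
  have pE : p = 1 - q by lra.
  by rewrite pE; field; rewrite -pE gt_eqF.
apply: state_closed_line => eps e0.
have [n qn] := @expr_small q (eps * p) ltac:(by rewrite q0 -pq ltrDr) ltac:(by rewrite mulr_gt0).
exists ((1 - q ^+ n) / p); split=> //.
have -> : p^-1 - (1 - q ^+ n) / p = q ^+ n / p by rewrite mulrBl mul1r subKr.
by rewrite ger0_norm ?ltr_pdivrMr // divr_ge0 ?exprn_ge0 // ltW.
Qed.

Lemma test_scalar (a : R) : isT (a%:M : 'M[R]_(sdim O S1)) -> Test S1 S1 [:: a%:M; (1 - a)%:M].
Proof.
move=> /(isT_split HO)[a' ta]; have := test_prob2 ta.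
rewrite (eff1 HO) !mul1mx => aa'.
suff -> : (1 - a)%:M = a' by [].
by apply: prP; rewrite [LHS]/pr mxE eqxx mulr1n -aa' {1}/pr mxE eqxx mulr1n addrAC subrr add0r.
Qed.

Lemma state_mix_of A (a : R) (v w : 'cV[R]_(sdim O A)) :
  isT (a%:M : 'M[R]_(sdim O S1)) -> is_state v -> is_state w -> is_state (a *: v + (1 - a) *: w).
Proof.
move=> /test_scalar ta hv hw; have := isT_cond2 HO ta hv hw.
by rewrite !mul_mx_scalar -!stvZ -stvD.
Qed.

(** Tosses of one coin of bias [p] simulate [x] to any precision: a toss reduces the problem to
    [x / p] or [(x - p) / (1 - p)] and multiplies the error by at most [r]. Closedness gives the
    limit. *)
Lemma isT_prob (x : R) : 0 <= x <= 1 -> isT (x%:M : 'M[R]_(sdim O S1)).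
Proof.
have [P [PT /andP[p0 p1]]] := ax_nondet HO; set p := pr P in p0 p1.
have {}PT : isT (p%:M : 'M[R]_(sdim O S1)).
  by rewrite (_ : p%:M = P) //; apply: prP; rewrite /pr mxE eqxx.
have E (y : R) : stv (y *: const_mx 1) = (y%:M : 'M[R]_(sdim O S1)).
  by apply/matrixP => i j; rewrite !mxE (ordI i) (ordI j) eqxx mulr1.
have h1 : is_state (const_mx 1 : 'cV[R]_(sdim O S1)).
  by rewrite /is_state -[const_mx 1]scale1r E; exact: isT_id.
pose r := Num.max p (1 - p).
have r01 : 0 <= r < 1 by rewrite /r le_max gt_max p1 (ltW p0) /=; lra.
have happ n : forall x, 0 <= x <= 1 -> exists y, is_state (y *: (const_mx 1 : 'cV[R]_(sdim O S1))) /\ `|x - y| <= r ^+ n.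
  elim: n => [|n IH] {}x /andP[x0 x1].
    exists 0; rewrite scale0r; split; first exact: state_0 h1.
    by rewrite expr0 subr0 ger0_norm.
  have r0 : 0 <= r by case/andP: r01.
  have rn : 0 <= r ^+ n by rewrite exprn_ge0.
  have [xp|px] := leP x p.
    have [|y [hy xy]] := IH (x / p); first by rewrite divr_ge0 ?(ltW p0) //= ler_pdivrMr // mul1r.
    exists (p * y); split.
      have := state_mix_of PT hy (state_0 h1).
      by rewrite scaler0 addr0 scalerA.
    have -> : x - p * y = p * (x / p - y) by field; rewrite gt_eqF.
    rewrite normrM exprS ler_pM // ger0_norm ?(ltW p0) // /r le_max lexx //.
  have p1' : 0 < 1 - p by lra.
  have [|y [hy xy]] := IH ((x - p) / (1 - p)).
    by rewrite divr_ge0 ?subr_ge0 ?(ltW px) ?(ltW p1) //= ler_pdivrMr // mul1r; lra.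
  exists (p + (1 - p) * y); split.
    have := state_mix_of PT h1 hy.
    by rewrite scalerA -scalerDl.
  have -> : x - (p + (1 - p) * y) = (1 - p) * ((x - p) / (1 - p) - y) by field; rewrite gt_eqF.
  rewrite normrM exprS ler_pM // ger0_norm ?(ltW p1') // /r le_max lexx orbT //.
move=> x01; rewrite -E; apply: state_closed_line => eps e0.
have [n rn] := expr_small r01 e0.
have [y [hy xy]] := happ n x x01.
by exists y; split=> //; exact: le_lt_trans rn.
Qed.

Lemma state_mix A (a : R) (v w : 'cV[R]_(sdim O A)) :
  0 <= a <= 1 -> is_state v -> is_state w -> is_state (a *: v + (1 - a) *: w).
Proof. by move=> /isT_prob; exact: state_mix_of. Qed.

Lemma state_cone A (v : 'cV[R]_(sdim O A)) : is_state v -> cone v.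
Proof. by exists 1, v; rewrite scale1r ler01. Qed.

Lemma cone_e_ge0 A (v : 'cV[R]_(sdim O A)) : cone v -> 0 <= (ev A *m v) 0 0.
Proof.
move=> [c [s [c0 hs ->]]]; rewrite -scalemxAr mxE mulr_ge0 // effect_ge0 //; exact: effect_ev.
Qed.

Lemma cone_e0 A (v : 'cV[R]_(sdim O A)) : cone v -> (ev A *m v) 0 0 = 0 -> v = 0.
Proof.
move=> [c [s [c0 hs ->]]]; rewrite -scalemxAr mxE => /eqP; rewrite mulf_eq0 => /orP[/eqP ->|/eqP s0].
  by rewrite scale0r.
by rewrite (state_e0 hs s0) scaler0.
Qed.

Lemma cone_norm A (v : 'cV[R]_(sdim O A)) : cone v -> v <> 0 ->
  0 < (ev A *m v) 0 0 /\ is_state (((ev A *m v) 0 0)^-1 *: v).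
Proof.
move=> Kv v0; have e0 : 0 < (ev A *m v) 0 0.
  by rewrite lt_neqAle cone_e_ge0 // andbT eq_sym; apply/eqP => /(cone_e0 Kv).
split=> //; case: Kv v0 e0 => [c [s [c0 hs ->]]] v0.
rewrite -scalemxAr mxE => e0.
have [cn0 s0] : c != 0 /\ (ev A *m s) 0 0 != 0.
  by apply/andP; rewrite -negb_or -mulf_eq0 gt_eqF.
rewrite scalerA (_ : _ * c = ((ev A *m s) 0 0)^-1); last by field; rewrite s0.
apply: state_normalize => //.
by rewrite lt_neqAle eq_sym s0 effect_ge0 //; exact: effect_ev.
Qed.

Lemma cone_state A (v : 'cV[R]_(sdim O A)) : cone v -> (ev A *m v) 0 0 <= 1 -> is_state v.
Proof.
move=> Kv v1; case: (eqVneq v 0) => [v0|/eqP v0].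
  by case: Kv => c [s [_ hs _]]; rewrite v0; exact: state_0 hs.
have [e0 hs] := cone_norm Kv v0.
have := @state_mix A ((ev A *m v) 0 0) _ _ _ hs (state_0 hs).
rewrite scaler0 addr0 scalerA divff ?gt_eqF // scale1r; apply.
by rewrite ltW.
Qed.

Lemma cone_scale A c (v : 'cV[R]_(sdim O A)) : 0 <= c -> cone v -> cone (c *: v).
Proof. by move=> c0 [d [s [d0 hs ->]]]; exists (c * d), s; rewrite scalerA mulr_ge0. Qed.

(** For nonzero summands, the sum is a positive multiple of a mixture of their normalizations,
    weighted by the shares of [a] and [b] in [a + b]. *)
Lemma cone_add A (v w : 'cV[R]_(sdim O A)) : cone v -> cone w -> cone (v + w).
Proof.
move=> Kv Kw.
case: (eqVneq v 0) => [->|/eqP v0]; first by rewrite add0r.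
case: (eqVneq w 0) => [->|/eqP w0]; first by rewrite addr0.
have [ev0 hv] := cone_norm Kv v0; have [ew0 hw] := cone_norm Kw w0.
set a := (_ *m v) 0 0 in ev0 hv; set b := (_ *m w) 0 0 in ew0 hw.
exists (a + b), ((a / (a + b)) *: (a^-1 *: v) + (1 - a / (a + b)) *: (b^-1 *: w)).
have ab : 0 < a + b by lra.
split; first exact: ltW.
  apply: state_mix => //; rewrite divr_ge0 ?(ltW ev0) ?(ltW ab) //= ler_pdivrMr // mul1r; lra.
rewrite scalerDr !scalerA.
have -> : (a + b) * (a / (a + b)) / a = 1 by field; rewrite !gt_eqF.
have -> : (a + b) * (1 - a / (a + b)) / b = 1 by field; rewrite !gt_eqF.
by rewrite !scale1r.
Qed.

Lemma cone_sum A (I : Type) (r : seq I) (P : pred I) (F : I -> 'cV[R]_(sdim O A)) :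
  cone (0 : 'cV[R]_(sdim O A)) -> (forall i, P i -> cone (F i)) -> cone (\sum_(i <- r | P i) F i).
Proof. by move=> K0 KF; elim/big_ind: _ => //; exact: cone_add. Qed.

Lemma cone_0 A (v : 'cV[R]_(sdim O A)) : cone v -> cone (0 : 'cV[R]_(sdim O A)).
Proof. by move=> /(cone_scale (lexx 0)); rewrite scale0r. Qed.

Lemma cone_mul A B (M : 'M[R]_(sdim O B, sdim O A)) v : isT M -> cone v -> cone (M *m v).
Proof.
move=> hM [c [s [c0 hs ->]]]; exists c, (M *m s).
by rewrite scalemxAr; split=> //; exact: state_mul.
Qed.

Lemma cone_effect_ge0 A (b : 'rV[R]_(sdim O A)) v : is_effect b -> cone v -> 0 <= (b *m v) 0 0.
Proof. by move=> hb [c [s [c0 hs ->]]]; rewrite -scalemxAr mxE mulr_ge0 // effect_ge0. Qed.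

(** The complement of [v] in a two-outcome test has probability zero, hence vanishes and can be
    merged into [v]. *)
Lemma test_state A (v : 'cV[R]_(sdim O A)) : is_state v -> (ev A *m v) 0 0 = 1 ->
  Test S1 A [:: stv v].
Proof.
move=> hv v1; have [s' ts] := isT_split HO hv.
have s0 : s' = 0.
  have hs : is_state (col (i0 O) s').
    by rewrite /is_state stvK; exists [:: stv v; s']; rewrite !inE eqxx orbT.
  rewrite -(stvK s') (state_e0 hs) ?stv0 //.
  have := test_prob2 ts; rewrite eff_rwv pr_rwv_stv v1 -(stvK s') pr_rwv_stv col_stv.
  lra.
by have := test_sum HO ts (ltn0Sn _); rewrite !big_cons big_nil s0 !addr0.
Qed.

(** Toss a coin of bias [(ev A *m v) 0 0], then prepare the normalization of [v] or of [w]. *)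
Lemma test_pair A (v w : 'cV[R]_(sdim O A)) : cone v -> cone w -> (ev A *m (v + w)) 0 0 = 1 ->
  Test S1 A [:: stv v; stv w].
Proof.
move=> Kv Kw e1.
have vw0 : v + w <> 0 by move=> vw; move: e1; rewrite vw mulmx0 mxE => /eqP; rewrite eq_sym oner_eq0.
have [_] := cone_norm (cone_add Kv Kw) vw0; rewrite e1 invr1 scale1r => hvw.
(* A vanishing branch has no normalization; [v + w] is its placeholder, prepared with weight
   zero. *)
have pick u : cone u -> exists2 t, Test S1 A [:: stv t] & u = (ev A *m u) 0 0 *: t.
  move=> Ku; case: (eqVneq u 0) => [->|/eqP u0].
    exists (v + w); first exact: test_state.
    by rewrite mulmx0 mxE scale0r.
  have [e0 hu] := cone_norm Ku u0; exists (((ev A *m u) 0 0)^-1 *: u).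
    by apply: test_state => //; rewrite -scalemxAr mxE mulVf // gt_eqF.
  by rewrite scalerA divff ?scale1r // gt_eqF.
have [v' tv vE] := pick v Kv; have [w' tw wE] := pick w Kw.
have ew : (ev A *m w) 0 0 = 1 - (ev A *m v) 0 0 by move: e1; rewrite mulmxDr mxE; lra.
have ev01 : 0 <= (ev A *m v) 0 0 <= 1.
  by rewrite cone_e_ge0 //= -subr_ge0 -ew cone_e_ge0.
have := ax_cond HO (u := fun i => if i is 0%N then [:: stv v'] else [:: stv w']) (test_scalar (isT_prob ev01)).
rewrite /= !mul_mx_scalar -!stvZ -vE -ew -wE; apply.
by case=> [|[|]].
Qed.

End Cone.

(** * Equality of matrices and full-rank families of rows *)

Lemma cV_ext (F : fieldType) m n (M N : 'M[F]_(m, n)) :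
  (forall v : 'cV_n, M *m v = N *m v) -> M = N.
Proof.
by move=> h; apply/matrixP => i j; have := h (delta_mx j 0); rewrite -!colE => /colP/(_ i); rewrite !mxE.
Qed.

(** Induction on the rank: while the rows have a nonzero kernel vector, some row satisfying [P] does
    not vanish on it and raises the rank. *)
Lemma separating_row_full (F : fieldType) n (P : 'rV[F]_n -> Prop) :
  (forall v : 'cV_n, (forall b, P b -> b *m v = 0) -> v = 0) ->
  exists k (M : 'M_(k, n)), (forall i, P (row i M)) /\ row_full M.
Proof.
move=> sep.
suff /(_ n (leqnn n))[k [M [PM rM]]] : forall m, (m <= n)%N ->
    exists k (M : 'M_(k, n)), (forall i, P (row i M)) /\ (m <= \rank M)%N.
  by exists k, M; split=> //; rewrite /row_full eqn_leq rank_leq_col.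
elim=> [|m IH] mn; first by exists 0%N, 0; split=> // -[].
have [k [M [PM]]] := IH (ltnW mn); rewrite leq_eqVlt => /orP[/eqP rM|]; last by exists k, M.
have [j cj] : exists j, col j (cokermx M) != 0.
  apply/existsP; apply: contraLR mn; rewrite -leqNgt => /existsPn c0.
  suff : \rank (cokermx M) = 0%N by rewrite mxrank_coker -rM => /eqP; rewrite subn_eq0.
  apply/eqP; rewrite mxrank_eq0; apply/eqP/matrixP => i j.
  by have := c0 j; rewrite negbK => /eqP/colP/(_ i); rewrite !mxE.
have Mj : M *m col j (cokermx M) = 0 by rewrite colE mulmxA mulmx_coker mul0mx.
have [b [Pb bj]] : exists b, P b /\ b *m col j (cokermx M) <> 0.
  apply: contrapT => nb; move/eqP: cj; apply; apply: sep => b Pb.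
  by apply: contrapT => bj; apply: nb; exists b.
exists (k + 1)%N, (col_mx M b); split.
  move=> i; case: (split_ordP i) => l ->.
    by rewrite (_ : row _ _ = row l M) //; apply/rowP => c; rewrite mxE col_mxEu [RHS]mxE.
  by rewrite (_ : row _ _ = b) //; apply/rowP => c; rewrite mxE col_mxEd ord1.
rewrite rM; apply: rank_ltmx; rewrite ltmxE col_mx_sub submx_refl /=.
have /andP[-> _] : ((M <= col_mx M b) && (b <= col_mx M b))%MS by rewrite -col_mx_sub submx_refl.
by apply/negP => /submxP[D bD]; apply: bj; rewrite bD -mulmxA Mj mulmx0.
Qed.

(** * Bipartite states as matrices *)

Section Bipartite.
Variables (R : realType) (O : OPT_data R) (HO : OPT_axioms O).
Local Notation S1 := (sI O).

(** With [A] on rows and [B] on columns, an effect on [B] acts by right multiplication with its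
    transpose. *)
Definition vecm A B (S : 'M[R]_(sdim O A, sdim O B)) : 'cV[R]_(sdim O (sc O A B)) :=
  \col_k S (unpair k).1 (unpair k).2.
Definition mat A B (v : 'cV[R]_(sdim O (sc O A B))) : 'M[R]_(sdim O A, sdim O B) :=
  \matrix_(a, b) v (pidx a b) 0.

Lemma vecmK A B : cancel (@vecm A B) (@mat A B).
Proof. by move=> S; apply/matrixP => a b; rewrite !mxE pidxK. Qed.

Lemma matK A B : cancel (@mat A B) (@vecm A B).
Proof. by move=> v; apply/colP => k; rewrite !mxE unpairK. Qed.

Lemma vecmE A B (S : 'M[R]_(sdim O A, sdim O B)) a b : vecm S (pidx a b) 0 = S a b.
Proof. by rewrite mxE pidxK. Qed.

Lemma vecmP A B (v w : 'cV[R]_(sdim O (sc O A B))) :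
  (forall a b, v (pidx a b) 0 = w (pidx a b) 0) -> v = w.
Proof. by move=> h; apply/colP => k; rewrite -(unpairK k) h. Qed.

Lemma vecmB A B (S T : 'M[R]_(sdim O A, sdim O B)) : vecm (S - T) = vecm S - vecm T.
Proof. by apply/colP => k; rewrite !mxE. Qed.

Lemma vecmD A B (S T : 'M[R]_(sdim O A, sdim O B)) : vecm (S + T) = vecm S + vecm T.
Proof. by apply/colP => k; rewrite !mxE. Qed.

Lemma vecmZ A B c (S : 'M[R]_(sdim O A, sdim O B)) : vecm (c *: S) = c *: vecm S.
Proof. by apply/colP => k; rewrite !mxE. Qed.

Lemma tens_vecm A B C D (M : 'M[R]_(sdim O B, sdim O A)) (N : 'M[R]_(sdim O D, sdim O C)) S :
  tens M N *m vecm S = vecm (M *m S *m N^T).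
Proof.
apply: vecmP => b d; rewrite vecmE mxE sum_pidx exchange_big mxE.
apply: eq_bigr => c _ /=; rewrite !mxE mulr_suml; apply: eq_bigr => a _.
by rewrite !mxE !pidxK mulrAC.
Qed.

Lemma swap_vecm A B (S : 'M[R]_(sdim O A, sdim O B)) : swapmx A B *m vecm S = vecm S^T.
Proof.
apply: vecmP => b a; rewrite vecmE mxE sum_pidx (bigD1 a) //= (bigD1 b) //=.
rewrite !mxE !pidxK !eqxx mul1r big1 ?addr0 => [|j jb].
  rewrite big1 ?addr0 // => i ia; rewrite big1 // => j _.
  by rewrite !mxE !pidxK (eq_sym a) (negPf ia) andbF mul0r.
by rewrite !mxE !pidxK (eq_sym b) (negPf jb) mul0r.
Qed.

Lemma ev_vecm A B (S : 'M[R]_(sdim O A, sdim O B)) :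
  ev (sc O A B) *m vecm S = ev A *m S *m (ev B)^T.
Proof.
apply/matrixP => i j; rewrite !ord1 mxE sum_pidx exchange_big mxE.
apply: eq_bigr => b _ /=; rewrite !mxE mulr_suml; apply: eq_bigr => a _.
by rewrite !mxE !pidxK (ax_eff_prod HO) mulrAC.
Qed.

Lemma margA_vecm A B (S : 'M[R]_(sdim O A, sdim O B)) :
  margA (stv (vecm S)) = stv (S *m (ev B)^T).
Proof.
by apply/matrixP => i j; rewrite !mxE; apply: eq_bigr => k _; rewrite !mxE pidxK mulrC.
Qed.

(* The identity of a system read through an equality X = Y given by [sc_assoc] or
   [sc_I]; basis indices are then matched by their values. *)
Definition relab (X Y : Sys O) : 'M[R]_(sdim O Y, sdim O X) := \matrix_(i, j) (i == j :> nat)%:R.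

Lemma relab1 X : relab X X = 1%:M.
Proof. by apply/matrixP => i j; rewrite !mxE. Qed.

Lemma relabE X Y (e : X = Y) (v : 'cV[R]_(sdim O X)) (i : 'I_(sdim O Y)) (j : 'I_(sdim O X)) :
  i = j :> nat -> (relab X Y *m v) i 0 = v j 0.
Proof. by subst Y; rewrite relab1 mul1mx => /val_inj ->. Qed.

Lemma rev_id X : rev_pair (1%:M : 'M[R]_(sdim O X)) 1%:M.
Proof.
have c1 : channel (1%:M : 'M[R]_(sdim O X)) by split; [exact: isT_id | rewrite mulmx1].
by split=> //; split=> //; rewrite mulmx1.
Qed.

Lemma rev_relab X Y (e : X = Y) : rev_pair (relab X Y) (relab Y X).
Proof. by subst Y; rewrite relab1; exact: rev_id. Qed.

Lemma rev_mul X Y Z (U : 'M[R]_(sdim O Y, sdim O X)) W (U' : 'M[R]_(sdim O Z, sdim O Y)) W' :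
  rev_pair U W -> rev_pair U' W' -> rev_pair (U' *m U) (W *m W').
Proof.
move=> [[U1 U2] [[W1 W2] [WU UW]]] [[U1' U2'] [[W1' W2'] [WU' UW']]]; split; last split; last split.
- by split; [exact: isT_mul | rewrite mulmxA U2' U2].
- by split; [exact: isT_mul | rewrite mulmxA W2 W2'].
- by rewrite mulmxA -(mulmxA W) WU' mulmx1.
- by rewrite mulmxA -(mulmxA U') UW mulmx1.
Qed.

Lemma channel_ev X Y (U : 'M[R]_(sdim O Y, sdim O X)) : channel U -> ev Y *m U = ev X.
Proof. by case=> _ h; rewrite /ev -row_mul h. Qed.

Lemma channelP X Y (U : 'M[R]_(sdim O Y, sdim O X)) : isT U -> ev Y *m U = ev X -> channel U.
Proof. by move=> hU h; split=> //; rewrite eff_rwv rwv_mul h -eff_rwv. Qed.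

Lemma channel_tens A B C D (M : 'M[R]_(sdim O B, sdim O A)) (N : 'M[R]_(sdim O D, sdim O C)) :
  channel M -> channel N -> channel (tens M N).
Proof.
move=> hM hN; apply: channelP; first by apply: isT_tens => //; [case: hM | case: hN].
apply: cV_ext => v; rewrite -(matK v) -mulmxA tens_vecm !ev_vecm.
by rewrite !mulmxA (channel_ev hM) -!mulmxA -trmx_mul (channel_ev hN).
Qed.

Lemma rev_tens A B C D (M : 'M[R]_(sdim O B, sdim O A)) (N : 'M[R]_(sdim O D, sdim O C)) M' N' :
  rev_pair M M' -> rev_pair N N' -> rev_pair (tens M N) (tens M' N').
Proof.
move=> [hM [hM' [e1 e2]]] [hN [hN' [e3 e4]]]; split; first exact: channel_tens.
split; first exact: channel_tens.
split; apply: cV_ext => v; rewrite -(matK v) -mulmxA !tens_vecm mul1mx !mulmxA -mulmxA -trmx_mul.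
  by rewrite e1 e3 mul1mx trmx1 mulmx1.
by rewrite e2 e4 mul1mx trmx1 mulmx1.
Qed.

(** The one-outcome swap followed by the deterministic effect is a one-outcome effect, so causality
    makes swaps channels. *)
Lemma rev_swap (A B : Sys O) : rev_pair (swapmx A B) (swapmx B A).
Proof.
have ch (X Y : Sys O) : channel (swapmx X Y).
  split; first exact: isT_test (ax_swap HO X Y).
  have := ax_seq HO (ax_swap HO X Y) (ax_eff_det HO (sc O Y X)).
  by move/(ax_eff_uniq HO).
by do 3![split=> //]; apply: cV_ext => v; rewrite -(matK v) -mulmxA !swap_vecm trmxK mul1mx.
Qed.

Lemma pidxA A B C (a : 'I_(sdim O A)) (b : 'I_(sdim O B)) (c : 'I_(sdim O C)) :
  pidx a (pidx b c) = pidx (pidx a b) c :> nat.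
Proof. by rewrite !val_pidx dim_sc mulnDl mulnA addnA. Qed.

Lemma pidx_I A (i : 'I_(sdim O A)) : pidx i (i0 O) = i :> nat.
Proof. by rewrite val_pidx (_ : nat_of_ord (i0 O) = 0%N) // dim_I muln1 addn0. Qed.

(** [A] is read as [A] composed with the trivial system, on which [beta] is prepared. *)
Lemma isT_embed A B (beta : 'cV[R]_(sdim O B)) : is_state beta ->
  exists2 M : 'M[R]_(sdim O (sc O A B), sdim O A), isT M &
    forall alpha : 'cV[R]_(sdim O A), M *m alpha = vecm (alpha *m beta^T).
Proof.
move=> hb; exists (tens 1%:M (stv beta) *m relab A (sc O A S1)).
  apply: isT_mul => //; first by apply: isT_tens => //; exact: isT_id.
  by case: (rev_relab (esym (sc_I O A))) => -[].
move=> alpha; rewrite -mulmxA -(matK (relab _ _ *m alpha)) tens_vecm mul1mx.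
congr vecm; apply/matrixP => a b; rewrite !mxE big_ord1 (big_pred1 (i0 O)); last first.
  by move=> k; rewrite /= (ordI k) eqxx.
by rewrite !mxE -(relabE (esym (sc_I O A)) _ (pidx_I a)) mxE.
Qed.

Lemma cone_prod A B (a : 'cV[R]_(sdim O A)) (b : 'cV[R]_(sdim O B)) :
  cone a -> cone b -> cone (vecm (a *m b^T)).
Proof.
move=> Ka [c [s [c0 hs ->]]]; rewrite linearZ/= -scalemxAr vecmZ; apply: cone_scale => //.
by have [M hM <-] := isT_embed A hs; exact: cone_mul.
Qed.

(** The effect leaves an unnormalized conditional state of [A] with a trivial factor, which [relab]
    removes. *)
Lemma cone_contract A B (S : 'M[R]_(sdim O A, sdim O B)) b : is_effect b -> cone (vecm S) -> cone (S *m b^T).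
Proof.
move=> hb KS.
have hM : isT (relab (sc O A S1) A *m tens 1%:M (rwv b)).
  apply: isT_mul => //; last by apply: isT_tens => //; exact: isT_id.
  by case: (rev_relab (sc_I O A)) => -[].
have := cone_mul HO hM KS; congr (cone _); rewrite -mulmxA tens_vecm mul1mx.
apply/colP => a; rewrite (relabE (sc_I O A) _ (esym (pidx_I a))) vecmE !mxE.
by apply: eq_bigr => k _; rewrite !mxE.
Qed.

Lemma cone_swap A B (S : 'M[R]_(sdim O A, sdim O B)) : cone (vecm S) -> cone (vecm S^T).
Proof. by rewrite -swap_vecm; apply: cone_mul; case: (rev_swap A B) => -[]. Qed.

Lemma neq0_cone A (v : 'cV[R]_(sdim O A)) : v <> 0 -> cone (0 : 'cV[R]_(sdim O A)).
Proof.
move=> v0; have [[|k] [c [s [hs vE]]]] := ax_span HO (stv v).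
  by case: v0; apply: stv_inj; rewrite vE big_ord0 stv0.
exists 0, (col (i0 O) (s ord0)); rewrite scale0r lexx; split=> //.
by rewrite /is_state stvK.
Qed.

Lemma cone_span A (v : 'cV[R]_(sdim O A)) : cone (0 : 'cV[R]_(sdim O A)) ->
  exists p q, [/\ cone p, cone q & v = p - q].
Proof.
move=> K0; have [k [c [s [hs vE]]]] := ax_span HO (stv v).
have Ks i : cone (col (i0 O) (s i)) by apply: state_cone => //; rewrite /is_state stvK.
exists (\sum_i Num.max (c i) 0 *: col (i0 O) (s i)), (\sum_i Num.max (- c i) 0 *: col (i0 O) (s i)).
split; try by apply: cone_sum => // i _; apply: cone_scale => //; rewrite le_max lexx orbT.
rewrite -sumrB -(col_stv v) vE linear_sum; apply: eq_bigr => i _.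
rewrite -scalerBl linearZ /=; congr (_ *: _).
by have [c0|c0] := leP (c i) 0; rewrite /Num.max; do 2?case: ltP => ?; lra.
Qed.

(** [ax_sep] concerns states only. Writing [v] as a difference of cone elements reduces to it: both
    terms have the same weight under [ev A], so they are normalized by the same factor. *)
Lemma effect_sep A (v : 'cV[R]_(sdim O A)) : (forall b, is_effect b -> b *m v = 0) -> v = 0.
Proof.
move=> h; apply: contrapT => v0; have K0 := neq0_cone v0.
have [p [q [Kp Kq vE]]] := cone_span v K0.
have bpq b : is_effect b -> (b *m p) 0 0 = (b *m q) 0 0.
  by move=> /h; rewrite vE mulmxBr => /matrixP/(_ 0 0); rewrite !mxE => /eqP; rewrite subr_eq0 => /eqP.
have epq := bpq _ (effect_ev HO A).
apply: v0; rewrite vE; apply/eqP; rewrite subr_eq0; apply/eqP.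
case: (eqVneq p 0) => [p0|/eqP p0].
  by rewrite p0; apply/esym/(cone_e0 HO) => //; rewrite -epq p0 mulmx0 mxE.
have [ep hp] := cone_norm HO Kp p0.
have q0 : q <> 0 by move=> q0; move: ep; rewrite epq q0 mulmx0 mxE ltxx.
have [eq hq] := cone_norm HO Kq q0.
have : ((ev A *m p) 0 0)^-1 *: p = ((ev A *m q) 0 0)^-1 *: q.
  by apply: state_sep => // b hb; rewrite -!scalemxAr [LHS]mxE [RHS]mxE epq bpq.
by rewrite epq => /(scalerI _); apply; rewrite invr_eq0 gt_eqF.
Qed.

Lemma effect_sep_mx m A (S : 'M[R]_(m, sdim O A)) : (forall b, is_effect b -> S *m b^T = 0) -> S = 0.
Proof.
move=> h; apply/row_matrixP => i; rewrite row0; apply: trmx_inj; rewrite trmx0.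
by apply: effect_sep => b hb; apply: trmx_inj; rewrite trmx_mul trmxK trmx0 -row_mul h // row0.
Qed.

Lemma effect_full A : exists k (M : 'M[R]_(k, sdim O A)), (forall i, is_effect (row i M)) /\ row_full M.
Proof. by apply: separating_row_full => v; exact: effect_sep. Qed.

End Bipartite.

(** Hyperplanes are closed: a positive deviation [d] at [v] would be bounded by something strictly
    smaller than [d]. *)
Lemma closed_linear_eq (R : realType) n (f : 'rV[R]_n) (c : R) (v : 'cV[R]_n) :
  (forall eps, 0 < eps -> exists w : 'cV[R]_n, (f *m w) 0 0 = c /\ forall i, `|v i 0 - w i 0| < eps) ->
  (f *m v) 0 0 = c.
Proof.
move=> h; apply/eqP; rewrite -subr_eq0 -normr_le0 leNgt; apply/negP => d0.
have s0 : 0 <= \sum_i `|f 0 i| by apply: sumr_ge0.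
have m0 : 0 < 1 + \sum_i `|f 0 i| by lra.
have [w [wc vw]] := h _ (divr_gt0 d0 m0).
set d := `|_ - c| in d0 vw; suff : d < d by rewrite ltxx.
have {1}-> : d = `|\sum_i f 0 i * (v i 0 - w i 0)|.
  by rewrite /d -wc !mxE -sumrB; congr `|_|; apply: eq_bigr => i _; rewrite mulrBr.
apply: (le_lt_trans (ler_norm_sum _ _ _)).
apply: (@le_lt_trans _ _ (\sum_i `|f 0 i| * (d / (1 + \sum_i `|f 0 i|)))).
  by apply: ler_sum => i _; rewrite normrM ler_wpM2l // ltW.
by rewrite -mulr_suml mulrA ltr_pdivrMr // mulrC ltr_pM2l //; lra.
Qed.

(** * Pure states *)

Section Pure.
Variables (R : realType) (O : OPT_data R) (HO : OPT_axioms O).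
Local Notation S1 := (sI O).
Local Notation Test := (Test O).

(** Atomicity of a normalized state as extremality of its ray in the cone, with no mention of tests;
    [pure_atomic] and [atomic_pure] give the equivalence. *)
Definition pure A (v : 'cV[R]_(sdim O A)) := [/\ cone v, (ev A *m v) 0 0 = 1 &
  forall D, cone D -> cone (v - D) -> exists c, D = c *: v].

Lemma normalizedE A (v : 'cV[R]_(sdim O A)) : normalized (stv v) <-> (ev A *m v) 0 0 = 1.
Proof. by rewrite /normalized eff_rwv pr_rwv_stv. Qed.

Lemma pure_atomic A (v : 'cV[R]_(sdim O A)) : pure v -> atomic (stv v).
Proof.
move=> [Kv v1 ext]; split; first by apply: (cone_state HO); rewrite ?v1.
move=> D [t [Y0 [tt [vE [i [Yi DE]]]]]].
have Kt (k : 'I_(size t)) : cone (col (i0 O) t`_k).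
  by apply: state_cone; rewrite /is_state stvK; exists t; split=> //; exact: mem_nth.
have KD : cone (col (i0 O) D) by rewrite DE.
have KvD : cone (v - col (i0 O) D).
  rewrite -(col_stv v) vE (bigD1 i) //= DE linearD/= addrAC subrr add0r linear_sum.
  by apply: cone_sum => // [|k _]; [exact: cone_0 KD | exact: Kt].
have [c cD] := ext _ KD KvD.
have ce : (ev A *m col (i0 O) D) 0 0 = c by rewrite cD -scalemxAr mxE v1 mulr1.
exists c; split; last by rewrite -stvZ -cD stvK.
rewrite -{1}ce cone_e_ge0 //=.
by have := cone_e_ge0 HO KvD; rewrite mulmxBr mxE v1 mxE ce subr_ge0.
Qed.

(** [test_pair] realizes the splitting of [v] into [D] and [v - D] as a test, so that [D] refines
    [v]. *)
Lemma atomic_pure A (v : 'cV[R]_(sdim O A)) : atomic (stv v) -> normalized (stv v) -> pure v.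
Proof.
move=> [vT ext] /normalizedE v1; split=> //; first exact: state_cone.
move=> D KD KvD.
have tD : Test S1 A [:: stv D; stv (v - D)] by apply: test_pair => //; rewrite addrC subrK.
have [|l [_ h]] := ext (stv D).
  exists [:: stv D; stv (v - D)], predT; split=> //; split.
    by rewrite (sum_nth [:: _; _]) !big_cons big_nil addr0 -stvD addrC subrK.
  by exists ord0.
by exists l; apply: stv_inj; rewrite h stvZ.
Qed.

Lemma pure_coef A (v : 'cV[R]_(sdim O A)) c : pure v -> (ev A *m (c *: v)) 0 0 = c.
Proof. by case=> _ v1 _; rewrite -scalemxAr mxE v1 mulr1. Qed.

Lemma pure_dom A (v : 'cV[R]_(sdim O A)) c D : pure v -> 0 <= c -> cone D -> cone (c *: v - D) ->
  D = (ev A *m D) 0 0 *: v.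
Proof.
move=> pv c0 KD KcD.
suff [d dE] : exists d, D = d *: v by rewrite {1}dE dE pure_coef.
case: (ltgtP c 0) c0 => // [c_gt0 _|cE _].
  have [||d dE] := (let: And3 _ _ ext := pv in ext) (c^-1 *: D).
  - by apply: cone_scale => //; rewrite invr_ge0 ltW.
  - have : cone (c^-1 *: (c *: v - D)) by apply: cone_scale => //; rewrite invr_ge0 ltW.
    by rewrite scalerBr scalerA mulVf ?gt_eqF // scale1r.
  by exists (c * d); rewrite -scalerA -dE scalerA divff ?scale1r // gt_eqF.
exists 0; rewrite scale0r; apply: (cone_e0 HO KD); apply/eqP; rewrite eq_le cone_e_ge0 // andbT.
by move: (cone_e_ge0 HO KcD); rewrite cE scale0r sub0r mulmxN mxE oppr_ge0.
Qed.

Lemma pure_rev A B (U : 'M[R]_(sdim O B, sdim O A)) W v : rev_pair U W -> pure v -> pure (U *m v).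
Proof.
move=> [hU [hW [WU UW]]] [Kv v1 ext]; split.
- by apply: cone_mul => //; case: hU.
- by rewrite mulmxA (channel_ev hU).
move=> D KD KvD; have [||c cE] := ext (W *m D).
- by apply: cone_mul => //; case: hW.
- rewrite -[v]mul1mx -WU -mulmxA -mulmxBr; apply: cone_mul => //; by case: hW.
by exists c; rewrite scalemxAr -cE mulmxA UW mul1mx.
Qed.

Lemma scalar11 (M : 'M[R]_1) : M = (M 0 0)%:M.
Proof. by apply/matrixP => i j; rewrite !ord1 mxE eqxx. Qed.

Lemma mxcol11 n (v : 'cV[R]_n) (M : 'M[R]_1) : v *m M = M 0 0 *: v.
Proof. by rewrite [M]scalar11 mul_mx_scalar -scalar11. Qed.

(** Contracting one factor of a dominated [S] with an effect leaves a multiple of the pure state of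
    the other. As effects separate, [S] factors from both sides. *)
Lemma pure_prod A B (a : 'cV[R]_(sdim O A)) (b : 'cV[R]_(sdim O B)) :
  pure a -> pure b -> pure (vecm (a *m b^T)).
Proof.
have slice X Y (x : 'cV[R]_(sdim O X)) (y : 'cV[R]_(sdim O Y)) S : pure x -> pure y ->
    cone (vecm S) -> cone (vecm (x *m y^T - S)) -> S = x *m (ev X *m S).
  move=> px [Ky _ _] KS KxyS; apply/eqP; rewrite -subr_eq0; apply/eqP.
  apply: (effect_sep_mx HO) => c hc; rewrite mulmxBl -!mulmxA; apply/eqP; rewrite subr_eq0; apply/eqP.
  have h0 : 0 <= (c *m y) 0 0 by exact: cone_effect_ge0.
  have := pure_dom px h0 (cone_contract HO hc KS).
  rewrite mxcol11; apply; have := cone_contract HO hc KxyS.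
  have yc : y^T *m c^T = ((c *m y) 0 0)%:M by rewrite -trmx_mul; apply/matrixP => i j; rewrite !ord1 [RHS]mxE mxE.
  by rewrite mulmxBl -mulmxA yc mul_mx_scalar.
move=> pa pb; have [Ka a1 _] := pa; have [Kb b1 _] := pb; split.
- exact: cone_prod.
- by rewrite ev_vecm // -!mulmxA -trmx_mul mulmxA !mxE big_ord1 [X in _ * X]mxE a1 b1 mulr1.
move=> D KD KvD; rewrite -(matK D) -vecmB in KvD; rewrite -(matK D) in KD *.
set S := mat D in KD KvD *.
have S1E := slice _ _ _ _ _ pa pb KD KvD.
have S2E : S^T = b *m (ev B *m S^T).
  apply: (slice _ _ b a) => //; first exact: cone_swap.
  by have := cone_swap HO KvD; rewrite linearB/= trmx_mul trmxK.
exists ((ev A *m S *m (ev B)^T) 0 0); rewrite -vecmZ; congr vecm.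
rewrite {1}S1E -[S in LHS]trmxK S2E trmx_mul [(ev B *m _)^T]trmx_mul trmxK mulmxA mulmxA.
by rewrite -(mulmxA a) (mxcol11 a) -scalemxAl mulmxA.
Qed.

(** Finitely many effects of full rank determine the coordinates linearly, and their values on
    states lie between 0 and 1. *)
Lemma states_bounded A : exists M, forall v : 'cV[R]_(sdim O A), is_state v -> forall i, `|v i 0| <= M.
Proof.
have [k [M [hM fM]]] := effect_full HO A.
exists (\sum_i \sum_j `|pinvmx M i j|) => v hv i.
have -> : v i 0 = (pinvmx M *m (M *m v)) i 0 by rewrite mulmxA mulVpmx // mul1mx.
rewrite mxE; apply: (le_trans (ler_norm_sum _ _ _)).
apply: (@le_trans _ _ (\sum_j `|pinvmx M i j|)).
  apply: ler_sum => j _; rewrite normrM ler_piMr //.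
  have -> : (M *m v) j 0 = (row j M *m v) 0 0 by rewrite -row_mul [RHS]mxE.
  by rewrite ger0_norm ?effect_ge0 // effect_le1.
rewrite (bigD1 i) //= lerDl; apply: sumr_ge0 => j _; exact: sumr_ge0.
Qed.

(** The first hypothesis says that the kernel of [L] cuts a face out of the cone. An extreme point
    of its compact normalized slice is therefore extreme among all normalized states. *)
Lemma exists_pure_face A m (L : 'M[R]_(m, sdim O A)) (f : 'rV[R]_(sdim O A)) v0 :
  (forall u w, cone u -> cone w -> L *m (u + w) = 0 -> L *m u = 0) ->
  cone v0 -> (ev A *m v0) 0 0 = 1 -> L *m v0 = 0 -> 0 < (f *m v0) 0 0 ->
  exists v, [/\ pure v, L *m v = 0 & 0 < (f *m v) 0 0].
Proof.
move=> face Kv0 e0 L0 f0.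
have [M bdM] := states_bounded A.
pose S v := [/\ is_state v, (ev A *m v) 0 0 = 1 & L *m v = 0].
have KS v : cone v -> (ev A *m v) 0 0 = 1 -> L *m v = 0 -> S v.
  by move=> Kv v1 Lv; split=> //; apply: (cone_state HO) => //; rewrite v1.
have [|||v [[hv v1 Lv] fv ext]] := @closed_bounded_extreme R _ S M f v0 _ _ _ f0.
- move=> v h; split.
  + by apply: (state_closed HO) => eps /h[w [[hw _ _] vw]]; exists w.
  + by apply: closed_linear_eq => eps /h[w [[_ hw _] vw]]; exists w.
  + apply/row_matrixP => i; rewrite row0 row_mul; apply/matrixP => a b; rewrite !ord1 [RHS]mxE.
    apply: closed_linear_eq => eps /h[w [[_ _ hw] vw]]; exists w; split=> //.
    by rewrite -row_mul hw row0 mxE.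
- by move=> v [hv _ _]; exact: bdM.
- exact: KS.
exists v; split=> //; split=> //; first exact: state_cone.
move=> D KD KvD.
have vE : v = D + (v - D) by rewrite addrC subrK.
case: (eqVneq D 0) => [->|/eqP D0]; first by exists 0; rewrite scale0r.
case: (eqVneq (v - D) 0) => [/eqP|/eqP D1].
  by rewrite subr_eq0 => /eqP <-; exists 1; rewrite scale1r.
have [eD hD] := cone_norm HO KD D0; have [eD1 hD1] := cone_norm HO KvD D1.
have eE : (ev A *m (v - D)) 0 0 = 1 - (ev A *m D) 0 0 by rewrite mulmxBr mxE v1 mxE.
have LD : L *m D = 0 by apply: (face _ _ KD KvD); rewrite -vE.
have LvD : L *m (v - D) = 0 by rewrite mulmxBr Lv LD subrr.
have nrm u : cone u -> 0 < (ev A *m u) 0 0 -> L *m u = 0 -> S (((ev A *m u) 0 0)^-1 *: u).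
  move=> Ku eu Lu; apply: KS.
  - by apply: cone_scale => //; rewrite invr_ge0 ltW.
  - by rewrite -scalemxAr mxE mulVf // gt_eqF.
  - by rewrite -scalemxAr Lu scaler0.
(* [v] is the mixture of the normalizations of [D] and [v - D], the first with weight
   [(ev A *m D) 0 0]. *)
have [||DE _] := ext _ _ ((ev A *m D) 0 0) (nrm _ KD eD LD) (nrm _ KvD eD1 LvD).
- by rewrite eD -subr_gt0 -eE.
- by rewrite -eE !scalerA !divff ?gt_eqF // !scale1r.
by exists ((ev A *m D) 0 0); rewrite -DE scalerA divff ?gt_eqF // scale1r.
Qed.

Lemma exists_pure A (v0 : 'cV[R]_(sdim O A)) : cone v0 -> (ev A *m v0) 0 0 = 1 ->
  exists v : 'cV[R]_(sdim O A), pure v.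
Proof.
move=> Kv e1; have [|||v []] := @exists_pure_face A 1 0 (ev A) v0 _ Kv e1; rewrite ?mul0mx ?e1 //.
- by move=> u w _ _; rewrite !mul0mx.
- by move=> pv _ _; exists v.
Qed.

(** Expand [x] over a spanning family of effects b: each term contributes a nonnegative multiple of
    e - b or of e + b, both sums of effects. Positivity is stated on bipartite states, the form that
    steering takes. *)
Lemma effect_order_unit X (x : 'rV[R]_(sdim O X)) : exists c, 0 < c /\
  forall A (S : 'M[R]_(sdim O A, sdim O X)), cone (vecm S) -> cone (S *m (c *: ev X - x)^T).
Proof.
have [k [M [hM fM]]] := effect_full HO X.
pose y := x *m pinvmx M.
have xE : x = \sum_i y 0 i *: row i M by rewrite -mulmx_sum_row -mulmxA mulVpmx ?mulmx1.
have s0 : 0 <= \sum_i `|y 0 i| by apply: sumr_ge0.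
exists (1 + \sum_i `|y 0 i|); split; first by lra.
move=> A S KS; have KSe := cone_contract HO (effect_ev HO X) KS.
rewrite scalerDl scale1r scaler_suml {1}xE -addrA -sumrB linearD/= mulmxDr.
apply: cone_add => //; rewrite linear_sum/= mulmx_sumr; apply: cone_sum => // [|i _]; first exact: cone_0 KSe.
have Kb := cone_contract HO (hM i) KS.
have [y0|y0] := leP 0 (y 0 i).
  rewrite ger0_norm // -scalerBr linearZ/= -scalemxAr; apply: cone_scale => //.
  have [bs [hbs ->]] := effect_compl HO (hM i).
  rewrite addrAC subrr add0r linear_sum/= mulmx_sumr big_seq; apply: cone_sum => //; first exact: cone_0 KSe.
  by move=> b /hbs hb; exact: cone_contract.
rewrite ltr0_norm // -scaleNr -scalerDr linearZ/= -scalemxAr.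
apply: cone_scale; first by rewrite oppr_ge0 ltW.
by rewrite linearD/= mulmxDr; exact: cone_add.
Qed.

(** Each basis vector is a difference of two cone elements; the sum [w] of all these elements
    dominates every one of them. *)
Lemma cone_order_unit A : cone (0 : 'cV[R]_(sdim O A)) -> exists w : 'cV[R]_(sdim O A),
  cone w /\ forall v, exists c, 0 < c /\ cone (c *: w - v).
Proof.
move=> K0.
have /choice[pq hpq] : forall k, exists pq : 'cV[R]_(sdim O A) * 'cV[R]_(sdim O A),
    [/\ cone pq.1, cone pq.2 & delta_mx k 0 = pq.1 - pq.2].
  by move=> k; have [p [q h]] := cone_span HO (delta_mx k 0) K0; exists (p, q).
pose w := \sum_k ((pq k).1 + (pq k).2).
have Kpq k : cone ((pq k).1 + (pq k).2) by have [? ? _] := hpq k; exact: cone_add.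
have Kw : cone w by apply: cone_sum.
exists w; split=> // v.
have s0 : 0 <= \sum_i `|v i 0| by apply: sumr_ge0.
exists (1 + \sum_i `|v i 0|); split; first by lra.
have vE : v = \sum_k v k 0 *: delta_mx k 0.
  by rewrite {1}[v]matrix_sum_delta; apply: eq_bigr => i _; rewrite big_ord1.
rewrite scalerDl scale1r scaler_suml {2}vE -addrA -sumrB; apply: cone_add => //.
apply: cone_sum => // k _; have [Kp Kq ->] := hpq k.
rewrite /w (bigD1 k) //=; set z := \sum_(i | _) _.
have Kz : cone z by apply: cone_sum.
have [v0|v0] := leP 0 (v k 0).
  rewrite ger0_norm // -scalerBr; apply: cone_scale => //.
  rewrite (_ : _ - _ = z + ((pq k).2 + (pq k).2)); first by do !apply: cone_add.
  by apply/matrixP => i j; rewrite !mxE; lra.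
rewrite ltr0_norm // -scaleNr -scalerDr; apply: cone_scale; first by rewrite oppr_ge0 ltW.
rewrite (_ : _ + _ = z + ((pq k).1 + (pq k).1)); first by do !apply: cone_add.
by apply/matrixP => i j; rewrite !mxE; lra.
Qed.

End Pure.

(** * Steering *)

Section Steering.
Variables (R : realType) (O : OPT_data R) (HO : OPT_axioms O) (HP : Purification O).
Local Notation S1 := (sI O).

Lemma ev_sc A B : ev (sc O A B) = (vecm ((ev A)^T *m ev B))^T.
Proof.
apply: cV_ext => v; rewrite -(matK v) ev_vecm //.
apply/matrixP => i j; rewrite !ord1 [RHS]mxE sum_pidx exchange_big mxE.
apply: eq_bigr => b _ /=; rewrite mxE mulr_suml; apply: eq_bigr => a _.
by rewrite !mxE !pidxK !big_ord1 !mxE mulrAC.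
Qed.

Lemma effect_prod A B (a : 'rV[R]_(sdim O A)) (b : 'rV[R]_(sdim O B)) :
  is_effect a -> is_effect b -> is_effect (vecm (a^T *m b))^T.
Proof.
move=> ha hb.
have [[hr _] _] := rev_relab HO (sc_I O S1).
have := isT_mul HO hr (isT_tens HO ha hb); congr isT.
apply/matrixP => i k; rewrite (ordI i) -[RHS]mulr1 -(unpairK k).
have -> (M : 'M[R]_(sdim O S1, _)) : M (i0 O) (pidx (unpair k).1 (unpair k).2) =
    (M *m delta_mx (pidx (unpair k).1 (unpair k).2) 0) (i0 O) (0 : 'I_1).
  by rewrite -colE mxE.
rewrite -mulmxA (relabE (sc_I O S1) _ (esym (pidx_I (i0 O)))) -colE !mxE !pidxK !mulr1.
by rewrite big_ord1 !mxE.
Qed.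

Lemma mul_vecm_prod m A B (M : 'M[R]_(m, sdim O (sc O A B))) (x : 'rV[R]_(sdim O A))
    (y : 'rV[R]_(sdim O B)) i j :
  (M *m vecm (x^T *m y)) i j = \sum_a \sum_b M i (pidx a b) * (x 0 a * y 0 b).
Proof.
rewrite mxE sum_pidx; apply: eq_bigr => a _; apply: eq_bigr => b _.
by rewrite (ord1 j) vecmE mxE big_ord1 mxE.
Qed.

Lemma purify A (v : 'cV[R]_(sdim O A)) : cone v -> (ev A *m v) 0 0 = 1 ->
  exists B (G : 'M[R]_(sdim O A, sdim O B)), pure (vecm G) /\ G *m (ev B)^T = v.
Proof.
move=> Kv v1; have [] := HP.1 A (stv v).
- by apply: (cone_state HO); rewrite ?v1.
- exact/normalizedE.
move=> B [Psi [aPsi [nPsi mPsi]]].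
exists B, (mat (col (i0 O) Psi)); rewrite matK; split.
  by apply: (atomic_pure HO); rewrite stvK.
apply: stv_inj; rewrite -margA_vecm matK stvK; exact: mPsi.
Qed.

Lemma purify_uniq A B (S T : 'M[R]_(sdim O A, sdim O B)) :
  pure (vecm S) -> pure (vecm T) -> S *m (ev B)^T = T *m (ev B)^T ->
  exists U : 'M[R]_(sdim O B, sdim O B), isT U /\ T = S *m U^T.
Proof.
move=> pS pT ST.
have [|||U [[W [[hU _] _]] UE]] := HP.2 A B _ _ (pure_atomic HO pS) _ (pure_atomic HO pT) _ _.
- by apply: (proj2 (normalizedE _)); case: pS.
- by apply: (proj2 (normalizedE _)); case: pT.
- by rewrite !margA_vecm ST.
exists U; split=> //; rewrite -[T]vecmK -[S in RHS]vecmK.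
move: UE; rewrite mul_stv tens_vecm mul1mx => /(@stv_inj _ _ _ _ _) ->.
by rewrite !vecmK.
Qed.

Lemma margin_norm A B (S : 'M[R]_(sdim O A, sdim O B)) :
  (ev (sc O A B) *m vecm S) 0 0 = (ev A *m (S *m (ev B)^T)) 0 0.
Proof. by rewrite ev_vecm // mulmxA. Qed.

(** Supplies pure ancilla states: the marginal of [S] on [B] is a normalized cone element. *)
Lemma pure_right A B (S : 'M[R]_(sdim O A, sdim O B)) : pure (vecm S) ->
  exists b : 'cV[R]_(sdim O B), pure b.
Proof.
move=> [KS S1 _]; apply: (exists_pure HO (v0 := S^T *m (ev A)^T)).
  by apply: (cone_contract HO (effect_ev HO A)); exact: cone_swap.
rewrite -S1 margin_norm; transitivity ((ev A *m (S *m (ev B)^T))^T 0 0); last by rewrite mxE.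
by rewrite !trmx_mul trmxK mulmxA.
Qed.

(* D and its complement, flagged by perfectly distinguishable states of Q, form a
   state of AQ purified by some R.  Comparing it with P through the uniqueness of
   purifications on A((QR)B) turns the effect reading the flag into one on B. *)
Lemma steering A B (P : 'M[R]_(sdim O A, sdim O B)) (D : 'cV[R]_(sdim O A)) :
  pure (vecm P) -> cone D -> cone (P *m (ev B)^T - D) ->
  exists b, is_effect b /\ P *m b^T = D.
Proof.
move=> pP KD KD1; set D1 := _ - D in KD1; have [KP P1 _] := pP.
have [Q [r0 [r1 [e0 [e1 [r0T r1T n0 n1 [te p00 p01 _ _]]]]]]] := ax_pdist HO.
pose f0 : 'cV_(sdim O Q) := col (i0 O) r0; pose f1 : 'cV_(sdim O Q) := col (i0 O) r1.
pose x0 := row (i0 O) e0.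
have x0E : is_effect x0 by rewrite /is_effect rwvK; exists [:: e0; e1]; rewrite !inE eqxx.
have f0S : is_state f0 by rewrite /is_state stvK.
have f1S : is_state f1 by rewrite /is_state stvK.
have f0n : (ev Q *m f0) 0 0 = 1 by rewrite -pr_rwv_stv -eff_rwv stvK.
have f1n : (ev Q *m f1) 0 0 = 1 by rewrite -pr_rwv_stv -eff_rwv stvK.
have xf0 : (x0 *m f0) 0 0 = 1 by rewrite -pr_rwv_stv rwvK stvK.
have xf1 : (x0 *m f1) 0 0 = 0 by rewrite -pr_rwv_stv rwvK stvK.
(* [f0] flags [D] and [f1] flags its complement; [x0] reads the flag. *)
pose Sg := D *m f0^T + D1 *m f1^T.
have SgE (x : 'rV[R]_(sdim O Q)) : Sg *m x^T = (x *m f0) 0 0 *: D + (x *m f1) 0 0 *: D1.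
  have h (f : 'cV[R]_(sdim O Q)) : f^T *m x^T = ((x *m f) 0 0)%:M.
    by rewrite -trmx_mul; apply/matrixP => i j; rewrite !ord1 [RHS]mxE mxE.
  by rewrite mulmxDl -!mulmxA !h !mul_mx_scalar.
have KSg : cone (vecm Sg).
  by rewrite vecmD; apply: cone_add => //; apply: cone_prod => //; exact: state_cone.
have DD1 : D + D1 = P *m (ev B)^T by rewrite addrC subrK.
have Sg1 : (ev (sc O A Q) *m vecm Sg) 0 0 = 1.
  by rewrite margin_norm SgE f0n f1n !scale1r DD1 -margin_norm.
have [Rr [G [pG GE]]] := purify KSg Sg1.
set C := sc O Q Rr.
pose G' := mat (relab (sc O (sc O A Q) Rr) (sc O A C) *m vecm G).
have aE : sc O (sc O A Q) Rr = sc O A C by rewrite -sc_assoc.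
have pG' : pure (vecm G') by rewrite matK; apply: (pure_rev HO (rev_relab HO aE)).
have G'E a q r : G' a (pidx q r) = G (pidx a q) r.
  by rewrite mxE (relabE aE _ (pidxA a q r)) vecmE.
have [eta pe] := pure_right pG'.
have [eta' pe'] := pure_right pP.
have a2E : sc O (sc O A C) B = sc O A (sc O C B) by rewrite -sc_assoc.
(* [M1] pads [G'] with a pure state of [B]; [M2] below pads [P] with a pure state of [C]. Both thus
   purify over the same system. *)
pose M1 := mat (relab (sc O (sc O A C) B) (sc O A (sc O C B)) *m vecm (vecm G' *m eta'^T)).
have pM1 : pure (vecm M1).
  by rewrite matK; apply: (pure_rev HO (rev_relab HO a2E)); exact: pure_prod.
have M1E a c b : M1 a (pidx c b) = G' a c * eta' b 0.
  by rewrite mxE (relabE a2E _ (pidxA a c b)) vecmE mxE big_ord1 vecmE [eta'^T _ _]mxE.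
have M1x (x : 'rV[R]_(sdim O Q)) :
    M1 *m vecm ((vecm (x^T *m ev Rr))^T^T *m ev B) = Sg *m x^T.
  have [_ e1' _] := pe'.
  apply/matrixP => a j; rewrite mul_vecm_prod mxE sum_pidx; apply: eq_bigr => q _.
  have -> : Sg a q = \sum_r G (pidx a q) r * ev Rr 0 r.
    by rewrite -[Sg]vecmK -GE mxE mxE; apply: eq_bigr => r _; rewrite [(ev Rr)^T _ _]mxE.
  rewrite mulr_suml; apply: eq_bigr => r _; rewrite [x^T _ _]mxE.
  transitivity (G (pidx a q) r * ev Rr 0 r * x 0 q * (ev B *m eta') 0 0); last by rewrite e1' mulr1 (ord1 j).
  rewrite [(ev B *m eta') 0 0]mxE mulr_sumr; apply: eq_bigr => b _.
  rewrite M1E G'E [(vecm _)^T _ _]mxE vecmE mxE big_ord1 [x^T _ _]mxE; ring.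
have [Me hMe MeE] := isT_embed HO B (cone_state HO (let: And3 h _ _ := pe in h) ltac:(by case: pe => _ -> _)).
pose W := swapmx B C *m Me.
have WT : isT W by apply: isT_mul => //; case: (rev_swap HO B C) => -[].
have WE v : W *m v = vecm (eta *m v^T) by rewrite -mulmxA MeE swap_vecm trmx_mul trmxK.
pose M2 := P *m W^T.
have pM2 : pure (vecm M2).
  have a3E : sc O (sc O A B) C = sc O A (sc O B C) by rewrite -sc_assoc.
  have := pure_rev HO (rev_tens HO (rev_id HO A) (rev_swap HO B C))
    (pure_rev HO (rev_relab HO a3E) (pure_prod HO pP pe)).
  pose N := mat (relab (sc O (sc O A B) C) (sc O A (sc O B C)) *m vecm (vecm P *m eta^T)).
  congr pure.
  suff NE : N = P *m Me^T by rewrite -[relab _ _ *m _]matK -/N tens_vecm mul1mx NE -mulmxA -trmx_mul.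
  apply/row_matrixP => a; apply: trmx_inj; rewrite row_mul trmx_mul trmxK MeE.
  apply: vecmP => b c; rewrite vecmE [LHS]mxE [LHS]mxE [LHS]mxE.
  by rewrite (relabE a3E _ (pidxA a b c)) vecmE !mxE !big_ord1 !mxE pidxK.
have evW : ev (sc O C B) *m W = ev B.
  have [_ eta1 _] := pe.
  apply: cV_ext => v; rewrite -mulmxA WE ev_vecm // mulmxA -mulmxA -trmx_mul.
  by rewrite [ev C *m eta]scalar11 eta1 mul1mx; apply/matrixP => i j; rewrite !ord1 mxE.
(* Both have marginal [P *m (ev B)^T] on [A]. *)
have [|U [hU UE]] := purify_uniq pM2 pM1.
  rewrite -mulmxA -trmx_mul evW ev_sc trmxK.
  have := M1x (ev Q); rewrite -ev_sc => ->.
  by rewrite SgE f0n f1n !scale1r DD1.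
pose x := (vecm ((vecm (x0^T *m ev Rr))^T^T *m ev B))^T.
have xE : is_effect x by apply: effect_prod; [apply: effect_prod => // | ]; exact: effect_ev.
(* Adjoin [eta], apply [U], then read the flag: together an effect on [B]. *)
exists (x *m (U *m W)); split; first by apply: effect_mul => //; exact: isT_mul.
have xT : M1 *m x^T = Sg *m x0^T by rewrite -M1x; congr (_ *m _); exact: trmxK.
rewrite trmx_mul trmx_mul !mulmxA -/M2 -UE xT SgE xf0 xf1.
by rewrite scale1r scale0r addr0.
Qed.

End Steering.

Lemma mxBE (V : zmodType) m n (M N : 'M[V]_(m, n)) i j : (M - N) i j = M i j - N i j.
Proof. by rewrite !mxE. Qed.

(** * Probabilistic teleportation *)

Section Teleportation.
Variables (R : realType) (O : OPT_data R) (HO : OPT_axioms O) (HP : Purification O).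

Lemma swap_mxE A B m (M : 'M[R]_(sdim O (sc O A B), m)) b a j :
  (swapmx A B *m M) (pidx b a) j = M (pidx a b) j.
Proof.
transitivity (col j (swapmx A B *m M) (pidx b a) 0); first by rewrite [RHS]mxE.
by rewrite colE -mulmxA -colE -[col j M]matK swap_vecm vecmE !mxE.
Qed.

Lemma tens1_mat A B C (V : 'M[R]_(sdim O C, sdim O B)) (v : 'cV[R]_(sdim O (sc O A B))) a k :
  (tens (1%:M : 'M_(sdim O A)) V *m v) (pidx a k) 0 = (V *m (row a (mat v))^T) k 0.
Proof.
rewrite -{1}[v]matK tens_vecm mul1mx vecmE.
transitivity ((row a (mat v *m V^T))^T k 0); first by rewrite [RHS]mxE [RHS]mxE.
by rewrite row_mul trmx_mul trmxK.
Qed.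

(** Regrouping the product of [P] and [Q] as a state of AB' and BA' turns the map from [E] to P E Q
    into a contraction with one pure state, to which steering applies. *)
Lemma pure_interchange A B A' B' (P : 'M[R]_(sdim O A, sdim O B)) (Q : 'M[R]_(sdim O A', sdim O B')) :
  pure (vecm P) -> pure (vecm Q) ->
  exists N : 'M[R]_(sdim O (sc O A B'), sdim O (sc O B A')),
    pure (vecm N) /\ forall E, N *m vecm E = vecm (P *m E *m Q).
Proof.
move=> pP pQ.
(* Transposing [Q] orders the systems as A, B, B', A', so that only B and B' have to be
   exchanged. *)
have pQT : pure (vecm Q^T) by rewrite -swap_vecm; exact: (pure_rev HO (rev_swap HO A' B')).
pose u1 := vecm (vecm P *m (vecm Q^T)^T).
have a1 : sc O (sc O A B) (sc O B' A') = sc O A (sc O B (sc O B' A')) by rewrite -sc_assoc.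
have a2 : sc O B (sc O B' A') = sc O (sc O B B') A' by rewrite -sc_assoc.
have a3 : sc O (sc O B' B) A' = sc O B' (sc O B A') by rewrite -sc_assoc.
have a4 : sc O A (sc O B' (sc O B A')) = sc O (sc O A B') (sc O B A') by rewrite -sc_assoc.
have rV := rev_mul HO (rev_mul HO (rev_relab HO a2) (rev_tens HO (rev_swap HO B B') (rev_id HO A')))
  (rev_relab HO a3).
set V := relab _ _ *m _ in rV.
have VE (w : 'cV_(sdim O (sc O B (sc O B' A')))) b' b a' : (V *m w) (pidx b' (pidx b a')) 0 = w (pidx b (pidx b' a')) 0.
  rewrite /V -mulmxA (relabE a3 _ (pidxA b' b a')) -mulmxA -[relab _ _ *m w]matK tens_vecm vecmE.
  by rewrite trmx1 mulmx1 swap_mxE mxE (relabE a2 _ (esym (pidxA b b' a'))).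
pose N := mat (relab _ (sc O (sc O A B') (sc O B A')) *m (tens 1%:M V *m
  (relab _ (sc O A (sc O B (sc O B' A'))) *m u1))).
exists N; split.
  rewrite matK; apply: (pure_rev HO (rev_relab HO a4)).
  apply: (pure_rev HO (rev_tens HO (rev_id HO A) rV)).
  by apply: (pure_rev HO (rev_relab HO a1)); exact: pure_prod.
have NE a b' b a' : N (pidx a b') (pidx b a') = P a b * Q a' b'.
  rewrite mxE (relabE a4 _ (esym (pidxA a b' (pidx b a')))) tens1_mat VE.
  rewrite mxE mxE mxE (relabE a1 _ (pidxA a b (pidx b' a'))) vecmE mxE big_ord1 vecmE.
  by rewrite [(vecm _)^T _ _]mxE vecmE mxE.
move=> E; apply: vecmP => a b'; rewrite mxE vecmE sum_pidx exchange_big mxE.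
apply: eq_bigr => a' _ /=; rewrite mxE mulr_suml; apply: eq_bigr => b _.
by rewrite NE vecmE mulrAC.
Qed.

(* Purifying an order unit of the cone of X makes b |-> (b|F) injective on effects of X. *)
Lemma dominating_purification X (v : 'cV[R]_(sdim O X)) : pure v ->
  exists C (F : 'M[R]_(sdim O X, sdim O C)) (G : 'M[R]_(sdim O C, sdim O X)),
    pure (vecm F) /\ F *m G = 1%:M.
Proof.
move=> pv; have [Kv v1 _] := pv; have K0 := cone_0 Kv.
have [w [Kw wunit]] := cone_order_unit HO K0.
have ew : 0 < (ev X *m w) 0 0.
  have [c [c0 /(cone_e_ge0 HO)]] := wunit v.
  rewrite mulmxBr mxBE -scalemxAr mxE v1 subr_ge0 => h.
  by rewrite -(pmulr_rgt0 _ c0); apply: lt_le_trans h.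
set e := (ev X *m w) 0 0 in ew.
have [||C [F [pF FE]]] := purify HO HP (v := e^-1 *: w).
- by apply: cone_scale => //; rewrite invr_ge0 ltW.
- by rewrite -scalemxAr mxE mulVf // gt_eqF.
exists C, F.
(* The marginal of [F] is a normalized order unit, so steering puts every cone element in the range
   of [F]. *)
have Kin u : cone u -> exists y : 'cV[R]_(sdim O C), F *m y = u.
  move=> Ku; have [c [c0 Kcu]] := wunit u.
  have ce : 0 < c * e by rewrite mulr_gt0.
  have [||b [_ bE]] := @steering _ _ HO HP _ _ F ((c * e)^-1 *: u) pF.
  - by apply: cone_scale => //; rewrite invr_ge0 ltW.
  - rewrite FE (_ : _ - _ = (c * e)^-1 *: (c *: w - u)).
      by apply: cone_scale => //; rewrite invr_ge0 ltW.
    rewrite scalerBr scalerA; congr (_ *: _ - _).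
    by field; rewrite !gt_eqF.
  exists ((c * e) *: b^T); rewrite -scalemxAr bE scalerA divff ?scale1r //.
  by rewrite gt_eqF.
have /choice[y yE] : forall k, exists y : 'cV[R]_(sdim O C), F *m y = delta_mx k 0.
  move=> k; have [p [q [Kp Kq ->]]] := cone_span HO (delta_mx k 0) K0.
  have [y <-] := Kin _ Kp; have [z <-] := Kin _ Kq.
  by exists (y - z); rewrite mulmxBr.
exists (\matrix_(i, k) y k i 0); split=> //.
apply/matrixP => i k; have /colP/(_ i) := yE k; rewrite !mxE eqxx andbT => <-.
by apply: eq_bigr => j _; rewrite mxE.
Qed.

Lemma atomic_transfer A B A' B' (P : 'M[R]_(sdim O A, sdim O B)) (Q : 'M[R]_(sdim O A', sdim O B'))
    (T : 'M[R]_(sdim O A, sdim O B')) (X : 'M[R]_(sdim O B, sdim O A')) :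
  pure (vecm P) -> pure (vecm Q) -> pure (vecm T) -> P *m X *m Q = T ->
  exists (E : 'M[R]_(sdim O B, sdim O A')) p,
    [/\ atomic (rwv (vecm E)^T), 0 < p <= 1 & P *m E *m Q = p *: T].
Proof.
move=> pP pQ pT PXQ; have [KT T1 _] := pT.
have [N [pN NE]] := pure_interchange pP pQ; have [KN N1 _] := pN.
have [v pv] := pure_right HO pN.
have [C [F [G [pF FG]]]] := dominating_purification pv; have [KF _ _] := pF.
have pFT : pure (vecm F^T) by rewrite -swap_vecm; exact: (pure_rev HO (rev_swap HO _ C)).
have [KFT _ _] := pFT.
(* [F^T] encodes effects on BA' as vectors of [C], and [G^T] decodes them. *)
have GF b : G^T *m (F^T *m b) = b :> 'cV_(sdim O (sc O B A')).
  by rewrite mulmxA -trmx_mul FG trmx1 mul1mx.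
pose w := F^T *m (ev (sc O B A'))^T.
have [f fE] : exists f, f = ev (sc O A B') *m (N *m G^T) by eexists.
(* [L1] vanishes on encoded vectors; [L2] vanishes when the decoded vector contracts [N] to the
   multiple of [vecm T] given by [f]. *)
pose L1 := 1%:M - F^T *m G^T.
pose L2 := N *m G^T - vecm T *m f; pose L := col_mx L1 L2.
have L0 u : F^T *m (G^T *m u) = u -> N *m (G^T *m u) = (f *m u) 0 0 *: vecm T -> L *m u = 0.
  move=> h1 h2; rewrite mul_col_mx !mulmxBl mul1mx -!mulmxA h1 h2 subrr mxcol11 subrr.
  by rewrite col_mx0.
have L01 u : L *m u = 0 -> F^T *m (G^T *m u) = u /\ N *m (G^T *m u) = (f *m u) 0 0 *: vecm T.
  rewrite mul_col_mx => /eqP; rewrite col_mx_eq0 !mulmxBl mul1mx -!mulmxA mxcol11 !subr_eq0.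
  by move=> /andP[/eqP <- /eqP <-]; rewrite mulmxA.
have domE u c : 0 < c -> cone u -> cone (c *: w - u) -> exists b, is_effect b /\ u = c *: (F^T *m b^T).
  move=> c0 Ku Kwu; have [||b [hb bE]] := @steering _ _ HO HP _ _ F^T (c^-1 *: u) pFT.
  - by apply: cone_scale => //; rewrite invr_ge0 ltW.
  - rewrite -/w (_ : _ - _ = c^-1 *: (c *: w - u)).
      by apply: cone_scale => //; rewrite invr_ge0 ltW.
    by rewrite scalerBr scalerA mulVf ?gt_eqF // scale1r.
  by exists b; split=> //; rewrite bE scalerA divff ?gt_eqF // scale1r.
have dom u : F^T *m (G^T *m u) = u -> exists c, 0 < c /\ cone (c *: w - u).
  move=> uE; have [c [c0 /(_ _ _ KFT)]] := effect_order_unit HO (G^T *m u)^T.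
  rewrite linearB/= trmxK mulmxBr uE linearZ/= -scalemxAr => h.
  by exists c.
(* Each summand is dominated by a multiple of [w], so it encodes a multiple of an effect; purity of
   [T] then makes its contraction with [N] a multiple of [vecm T]. *)
have face u z : cone u -> cone z -> L *m (u + z) = 0 -> L *m u = 0.
  move=> Ku Kz /L01[h1 h2]; have [c [c0 Kc]] := dom _ h1.
  have [bu [hbu uE]] : exists b, is_effect b /\ u = c *: (F^T *m b^T).
    apply: domE => //; have := cone_add HO Kc Kz.
    by rewrite opprD addrA subrK.
  have [bz [hbz zE]] : exists b, is_effect b /\ z = c *: (F^T *m b^T).
    apply: domE => //; have := cone_add HO Kc Ku.
    by rewrite opprD [- u - z]addrC addrA subrK.
  have GK x b : is_effect b -> x = c *: (F^T *m b^T) -> cone (N *m (G^T *m x)).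
    move=> hb ->; rewrite -!scalemxAr GF; apply: cone_scale; first exact: ltW.
    exact: cone_contract.
  have f0 : 0 <= (f *m (u + z)) 0 0.
    rewrite fE -mulmxA; apply: (cone_e_ge0 HO); rewrite -mulmxA mulmxDr mulmxDr.
    by apply: cone_add => //; [apply: GK uE | apply: GK zE].
  apply: L0; first by rewrite uE -!scalemxAr GF.
  rewrite (pure_dom HO pT f0 (GK _ _ hbu uE)); first by rewrite fE -!mulmxA.
  by rewrite -h2 -mulmxBr -mulmxBr addrAC subrr add0r; apply: GK zE.
(* Although [X] need not be an effect, this bound puts [vecm T] below [c] times the marginal of [N],
   so steering provides the effect [b0]. *)
have [c [c0 /(_ _ _ KN)]] := effect_order_unit HO (vecm X)^T.
rewrite linearB/= trmxK mulmxBr NE PXQ linearZ/= -scalemxAr => KcT.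
have [||b0 [hb0 b0E]] := @steering _ _ HO HP _ _ N (c^-1 *: vecm T) pN.
- by apply: cone_scale => //; rewrite invr_ge0 ltW.
- rewrite (_ : _ - _ = c^-1 *: (c *: (N *m (ev (sc O B A'))^T) - vecm T)).
    by apply: cone_scale => //; rewrite invr_ge0 ltW.
  by rewrite scalerBr scalerA mulVf ?gt_eqF // scale1r.
pose s := F^T *m b0^T.
have Ks : cone s by exact: cone_contract.
have fs : (f *m s) 0 0 = c^-1.
  by rewrite fE -!mulmxA GF b0E -scalemxAr mxE T1 mulr1.
have Ls : L *m s = 0 by apply: L0; [rewrite GF | rewrite GF b0E fs].
have s0 : s <> 0 by move=> s0; move: fs; rewrite s0 mulmx0 mxE => /esym/eqP; rewrite invr_eq0 gt_eqF.
have [es _] := cone_norm HO Ks s0.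
have [||||t [pt Lt ft]] := exists_pure_face HO (f := f) (v0 := ((ev C *m s) 0 0)^-1 *: s) face.
- by apply: cone_scale => //; rewrite invr_ge0 ltW.
- by rewrite -scalemxAr mxE mulVf // gt_eqF.
- by rewrite -scalemxAr Ls scaler0.
- by rewrite -scalemxAr mxE fs mulr_gt0 // invr_gt0.
have [t1 t2] := L01 _ Lt; have [Kt e1 _] := pt.
have [d [d0 Kd]] := dom _ t1.
have [b [hb tE]] := domE _ _ d0 Kt Kd.
have bE : F^T *m b^T = d^-1 *: t by rewrite tE scalerA mulVf ?scale1r // gt_eqF.
have Nb : N *m b^T = (d^-1 * (f *m t) 0 0) *: vecm T.
  by rewrite -scalerA -t2 -[b^T]GF bE -!scalemxAr.
exists (mat b^T), (d^-1 * (f *m t) 0 0); split.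
(* Encoding a refinement of [b] gives an element below [d^-1 *: t]; purity of [t] makes it a
   multiple of [t], and decoding gives a multiple of [b]. *)
- rewrite matK trmxK; split=> // D [ts [Y0 [tts [bsum [i [Yi DE]]]]]].
  have hE (k : 'I_(size ts)) : is_effect (row (i0 O) ts`_k).
    by rewrite /is_effect rwvK; exists ts; split=> //; exact: mem_nth.
  have hD : is_effect (row (i0 O) D) by rewrite DE.
  have KD := cone_contract HO hD KFT.
  have KbD : cone (d^-1 *: t - F^T *m (row (i0 O) D)^T).
    have bD : b - row (i0 O) D = \sum_(k < size ts | Y0 k && (k != i)) row (i0 O) ts`_k.
      rewrite -[b in LHS]row_rwv bsum (bigD1 i) //= DE linearD/= addrAC subrr add0r.
      by rewrite linear_sum.
    rewrite -bE -mulmxBr -linearB/= bD linear_sum mulmx_sumr.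
    by apply: cone_sum => // [|k _]; [exact: cone_0 Kt | exact: cone_contract].
  have d'0 : 0 <= d^-1 by rewrite invr_ge0 ltW.
  have lE := pure_dom HO pt d'0 KD KbD.
  set l := (_ *m _) 0 0 in lE.
  have l0 : 0 <= l by exact: cone_e_ge0 KD.
  have ld : l <= d^-1.
    have := cone_e_ge0 HO KbD; by rewrite mulmxBr mxBE -scalemxAr mxE -/l e1 mulr1 subr_ge0.
  exists (l * d); split.
    by rewrite mulr_ge0 ?(ltW d0) //= -ler_pdivlMr // mul1r.
  have rD : row (i0 O) D = (l * d) *: b.
    apply: trmx_inj; rewrite -(GF (row _ _)^T) lE -scalemxAr tE -scalemxAr GF scalerA.
    by rewrite linearZ.
  by rewrite -(rwvK D) rD; apply/matrixP => x y; rewrite !mxE.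
- apply/andP; split; first by rewrite mulr_gt0 // invr_gt0.
  (* The scalar is the probability of [b] on the marginal of [N] on BA', hence at most 1. *)
  have hS : is_state (N^T *m (ev (sc O A B'))^T).
    apply: (cone_state HO); first by apply: (cone_contract HO (effect_ev HO _)); exact: cone_swap.
    rewrite -N1 margin_norm // le_eqVlt; apply/orP; left; apply/eqP.
    transitivity ((ev (sc O A B') *m (N *m (ev (sc O B A'))^T))^T 0 0); last by rewrite mxE.
    by rewrite !trmx_mul trmxK mulmxA.
  have := effect_le1 HO hb hS.
  have -> : b *m (N^T *m (ev (sc O A B'))^T) = (ev (sc O A B') *m (N *m b^T))^T.
    by rewrite !trmx_mul trmxK mulmxA.
  by rewrite mxE Nb -scalemxAr mxE T1 mulr1.
- by apply: (can_inj (@vecmK R O A B')); rewrite -NE matK Nb vecmZ.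
Qed.

End Teleportation.

(** * Recovery of the pure state and of the identity channel *)

Theorem mainTheorem8 (R : realType) (O : OPT_data R) (HO : OPT_axioms O)
  (HP : Purification O) (A B A' B' : Sys O)
  (UA : 'M[R]_(sdim O A', sdim O A)) (WA : 'M[R]_(sdim O A, sdim O A'))
  (UB : 'M[R]_(sdim O B', sdim O B))
  (HA : rev_pair UA WA) (HB : reversible UB)
  (Psi : 'M[R]_(sdim O (sc O A B), sdim O (sI O)))
  (HPsi : atomic Psi) (HPsin : normalized Psi) :
  exists (E : 'M[R]_(sdim O (sI O), sdim O (sc O B A'))) (p : R),
    [/\ atomic E, 0 < p <= 1,
        IEI E Psi (tens UA UB *m Psi) = p *: (tens 1%:M UB *m Psi) &
        internal (margA Psi) -> IE_tele E Psi = p *: WA].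
Proof.
have [WB hB] := HB; have [hUA [hWA [WU UW]]] := HA; have [_ [_ [WUB _]]] := hB.
pose P := mat (col (i0 O) Psi).
have PsiE : Psi = stv (vecm P) by rewrite matK stvK.
have pP : pure (vecm P) by apply: (atomic_pure HO); rewrite -PsiE.
have pQ : pure (vecm (UA *m P *m UB^T)).
  by rewrite -tens_vecm; exact: (pure_rev HO (rev_tens HO HA hB)).
have pT : pure (vecm (P *m UB^T)).
  by have := pure_rev HO (rev_tens HO (rev_id HO A) hB) pP; rewrite tens_vecm mul1mx.
have [Y PYP] : exists Y, P *m Y *m P = P by exists (pinvmx P); rewrite mulmxKpV // submx_refl.
(* [WA] cancels the [UA] in the second copy, and the generalized inverse [Y] absorbs the remaining
   [P]. *)
have [|E [p [aE p01 PEQ]]] := @atomic_transfer _ _ HO HP _ _ _ _ _ _ _ (Y *m WA) pP pQ pT.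
  by rewrite -!mulmxA (mulmxA WA) WU mul1mx !mulmxA PYP.
exists (rwv (vecm E)^T), p; split=> //.
  rewrite PsiE !mul_stv !tens_vecm mul1mx.
  apply/matrixP => k j; rewrite (ordI j) -[RHS]/((p *: stv (vecm (P *m UB^T))) k (i0 O)).
  rewrite -stvZ -vecmZ -PEQ !mxE exchange_big; apply: eq_bigr => a' _ /=.
  rewrite [(P *m E) _ _]mxE mulr_suml; apply: eq_bigr => b _.
  by rewrite !mxE !pidxK /=; congr (_ * _); rewrite mulrC.
move=> int; have PEU : P *m E *m UA *m P = p *: P.
  have := congr1 (fun M => M *m WB^T) PEQ.
  by rewrite !mulmxA -!scalemxAl -!(mulmxA _ UB^T) -!trmx_mul WUB !trmx1 !mulmx1.
(* Every refinement of the marginal is steered from [B], hence lies in the range of [P]; internality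
   makes [P] surjective. *)
have [S PS] : exists S, P *m S = 1%:M.
  have span (v : 'cV[R]_(sdim O A)) : exists y, P *m y = v.
    have [k [c [s [hs vE]]]] := int (stv v).
    have /choice[y yE] : forall i, exists y : 'cV[R]_(sdim O B), P *m y = col (i0 O) (s i).
      move=> i; have [t [Y0 [tt [mE [l [Yl sE]]]]]] := hs i.
      have Kt (q : 'I_(size t)) : cone (col (i0 O) t`_q).
        by apply: state_cone; rewrite /is_state stvK; exists t; split=> //; exact: mem_nth.
      have [||b [_ bE]] := @steering _ _ HO HP _ _ P (col (i0 O) (s i)) pP.
      - by rewrite sE.
      - have -> : P *m (ev B)^T = col (i0 O) (margA Psi) by rewrite PsiE margA_vecm col_stv.
        rewrite mE (bigD1 l) //= sE linearD/= addrAC subrr add0r linear_sum.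
        by apply: cone_sum => // [|q _]; [exact: cone_0 (Kt l) | exact: Kt].
      by exists b^T.
    exists (\sum_i c i *: y i); rewrite mulmx_sumr -(col_stv v) vE linear_sum.
    by apply: eq_bigr => i _; rewrite -scalemxAr yE linearZ.
  have /choice[y yE] := fun k : 'I_(sdim O A) => span (delta_mx k 0).
  exists (\matrix_(i, k) y k i 0).
  apply/matrixP => i k; have /colP/(_ i) := yE k; rewrite !mxE eqxx andbT => <-.
  by apply: eq_bigr => j _; rewrite mxE.
(* Cancel the right factor [P] by [S], then [UA] by [WA]. *)
have PE : P *m E = p *: WA.
  have := congr1 (fun M => M *m S *m WA) PEU.
  by rewrite -!scalemxAl PS mul1mx -(mulmxA _ P) PS mulmx1 -mulmxA UW mulmx1.
rewrite -PE PsiE; apply/matrixP => a a'; rewrite !mxE; apply: eq_bigr => b _.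
by rewrite !mxE !pidxK mulrC.
Qed.
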